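(* Let $v$ satisfy hypothesis (H), and let $\mu_0\in\mathcal{P}^{ac}_c$ be given. Let $\mu^k=\mu^k_{[0,T]}\in C([0,T],\mathcal{P}_p)$ be computed using Scheme 1 with $\Delta t=T/2^k$, starting with $\mu^k_0=\mu_0$. Then the limit $\bar\mu=\lim_{k}\mu^k$ exists (in $(C([0,T],\mathcal{P}_p),d)$) and is a solution of the Cauchy problem $\partial_t\mu+\nabla\cdot(v[\mu]\mu)=0$, $\mu_{|t=0}=\mu_0$.
   Context: Fix $p\ge 1$, $n\in\mathbb{N}$, $T>0$. $\mathcal{P}_p$ is the space of Radon probability measures on $\mathbb{R}^n$ with finite $p$-moment, endowed with the Wasserstein distance $W_p$; for absolutely continuous measures $W_p(\mu,\nu)=\inf\{(\int|\gamma(x)-x|^p d\mu)^{1/p}:\gamma\#\mu=\nu\}$, where $\gamma\#\mu(E)=\mu(\gamma^{-1}(E))$. $\mathcal{P}^{ac}_c\subset\mathcal{P}_p$ is the set of probability measures with compact support that are absolutely continuous with respect to Lebesgue measure. On $C([0,T],\mathcal{P}_p)$ set $d(\mu,\nu)=\sup_{t\in[0,T]}W_p(\mu_t,\nu_t)$. Hypothesis (H): $v:\mathcal{P}_p\to C^1(\mathbb{R}^n)\cap L^\infty(\mathbb{R}^n)$, $\mu\mapsto v[\mu]$ (vector fields on $\mathbb{R}^n$), and there are constants $L,M,K$ such that for all $\mu,\nu\in\mathcal{P}_p$, $x,y\in\mathbb{R}^n$: $|v[\mu](x)-v[\mu](y)|\le L|x-y|$, $|v[\mu](x)|\le M$,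 $\|v[\mu]-v[\nu]\|_{C^0}\le K\,W_p(\mu,\nu)$. Solution: $\mu\in C([0,T],\mathcal{P}^{ac}_c)$ with $\mu_{|t=0}=\mu_0$ and $\int_0^T\int_{\mathbb{R}^n}(\partial_t f+\nabla f\cdot v[\mu_t])\,d\mu_t\,dt=0$ for all $f\in C_c^\infty((0,T)\times\mathbb{R}^n)$. Scheme 1 (Lagrangian, semi-discrete in time): start from $\mu_0$. Given $\mu_{i\Delta t}$, let $v_{i\Delta t}:=v[\mu_{i\Delta t}]$, with flow $\Phi^{v_{i\Delta t}}_t$, and for $t\in[i\Delta t,(i+1)\Delta t]$ set $\mu_t:=\Phi^{v_{i\Delta t}}_{t-i\Delta t}\#\mu_{i\Delta t}$. Stop at $T$. With $\Delta t=T/2^k$ the result is denoted $\mu^k$. *)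

(* Defs.v *)
From HB Require Import structures.
From mathcomp Require Import all_boot all_order all_algebra.
From mathcomp Require Import all_classical all_reals all_analysis.

Set Implicit Arguments.
Unset Strict Implicit.
Unset Printing Implicit Defensive.

Import Order.TTheory GRing.Theory Num.Theory.
Import numFieldNormedType.Exports.

Local Open Scope classical_set_scope.
Local Open Scope ring_scope.

(* R^n is 'rV[R]_n. The library norm `|x| on it is the max norm; it is used
   only through the topology and the derivatives it induces (the same as for
   any other norm). All metric quantities use the Euclidean norm below. *)
Section euclidean.
Context {R : realType} {n : nat}.

Definition dotp (u w : 'rV[R]_n) : R := \sum_(i < n) u 0 i * w 0 i.

Definition enorm (x : 'rV[R]_n) : R := Num.sqrt (\sum_(i < n) x 0 i ^+ 2).

Definition C0norm (f : 'rV[R]_n -> 'rV[R]_n) : \bar R :=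
  ereal_sup (range (fun x => (enorm (f x))%:E)).

End euclidean.

(* Borel sigma-algebra on spaces of matrices, in particular on 'rV[R]_n. *)
Section borel_matrix.
Context (R : realType) (m n : nat).

Let borel : set (set 'M[R]_(m, n)) := <<s open >>.

Let borel0 : borel set0. Proof. exact: sigma_algebra0. Qed.

Let borelC A : borel A -> borel (~` A). Proof. exact: sigma_algebraC. Qed.

Let borel_bigcup (F : (set 'M[R]_(m, n))^nat) :
  (forall i, borel (F i)) -> borel (\bigcup_i F i).
Proof. exact: sigma_algebra_bigcup. Qed.

HB.instance Definition _ := @isMeasurable.Build
  (sigma_display (@open 'M[R]_(m, n))) 'M[R]_(m, n)
  borel borel0 borelC borel_bigcup.

End borel_matrix.

(* Lebesgue outer measure on R^n (n > 0), by countable covers by closed boxes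
   \prod_i [a_i, b_i]; Lebesgue measure is its restriction to measurable sets.
   For n = 0 every box has volume 1, so that no set is null and every measure
   is absolutely continuous, as it should be. *)
Section lebesgue_outer.
Context {R : realType} {n : nat}.

Definition box (a b : 'rV[R]_n) : set 'rV[R]_n :=
  [set x | forall i, a 0 i <= x 0 i <= b 0 i].

Definition lebesgue_outer (A : set 'rV[R]_n) : \bar R :=
  ereal_inf [set s | exists a b : nat -> 'rV[R]_n,
    [/\ forall k i, a k 0 i <= b k 0 i,
        A `<=` \bigcup_k box (a k) (b k) &
        s = (\sum_(0 <= k <oo) (\prod_(i < n) (b k 0 i - a k 0 i))%:E)%E]].

End lebesgue_outer.

(* Probability measures with finite p-moment. On R^n every Borel probability
   measure is Radon, so no separate regularity field is needed. *)
Record Pp (R : realType) (n : nat) (p : R) := MkPp {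
  Pp_measure :> probability 'rV[R]_n R ;
  Pp_moment : (\int[Pp_measure]_x ((enorm x) `^ p)%:E < +oo)%E }.

(* A measure of the library is a function on all subsets, whose values on
   non-measurable sets are irrelevant: equality of measures is [measure_eq]. *)
Definition measure_eq d (T : measurableType d) (R : realType)
    (m1 m2 : set T -> \bar R) : Prop :=
  forall A, measurable A -> m1 A = m2 A.

Section wasserstein.
Context {R : realType} {n : nat} {p : R}.

Definition coupling (mu nu : Pp n p)
    (pi : probability ('rV[R]_n * 'rV[R]_n)%type R) : Prop :=
  measure_eq (pushforward pi fst) mu /\ measure_eq (pushforward pi snd) nu.

(* General (Kantorovich) form, needed since mu and nu range over all of Pp. For
   absolutely continuous measures it equals the infimum over the maps pushing
   mu to nu. *)
Definition Wp (mu nu : Pp n p) : \bar R :=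
  ereal_inf [set poweR (\int[pi]_z ((enorm (z.1 - z.2)) `^ p)%:E) p^-1
            | pi in coupling mu nu].

Definition msupport (mu : Pp n p) : set 'rV[R]_n :=
  [set x | forall U, open U -> U x -> (0 < mu U)%E].

Definition Pcac (mu : Pp n p) : Prop :=
  compact (msupport mu) /\ (mu : set _ -> \bar R) `<< lebesgue_outer.

(* A curve [0, T] -> Pp is represented by a function on R, of which only the
   values on [0, T] matter. *)
Definition Ccurve (T : R) (mu : R -> Pp n p) : Prop :=
  forall t : R, t \in `[0, T] ->
    Wp (mu s) (mu t) @[s --> within [set` `[0, T]] (nbhs t)] --> 0%E.

Definition dcurve (T : R) (mu nu : R -> Pp n p) : \bar R :=
  ereal_sup [set Wp (mu t) (nu t) | t in [set` `[0, T]]].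

Definition cvg_curve (T : R) (muk : nat -> R -> Pp n p) (mu : R -> Pp n p) :
    Prop :=
  [/\ forall k, Ccurve T (muk k), Ccurve T mu &
      dcurve T (muk k) mu @[k --> \oo] --> 0%E].

End wasserstein.

(* C^k maps. For V of finite dimension, continuity of x |-> 'd f x h for every
   h is continuity of the differential. *)
Fixpoint Ck {R : realType} {V W : normedModType R} (k : nat) (f : V -> W) :
    Prop :=
  if k is k'.+1 then
    (forall x, differentiable f x) /\ forall h, Ck k' (fun x => 'd f x h)
  else continuous f.

Definition smooth {R : realType} {V W : normedModType R} (f : V -> W) : Prop :=
  forall k, Ck k f.

(* Membership of v[mu] in L^oo is the bound by M. *)
Definition hypH {R : realType} {n : nat} {p : R}
    (v : Pp n p -> 'rV[R]_n -> 'rV[R]_n) : Prop :=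
  (forall mu, Ck 1 (v mu)) /\
  exists L M K : R,
    [/\ forall mu x y, enorm (v mu x - v mu y) <= L * enorm (x - y),
        forall mu x, enorm (v mu x) <= M &
        forall mu nu,
          (C0norm (fun x => (v mu x - v nu x)%R) <= K%:E * Wp mu nu)%E].

Section cauchy_problem.
Context {R : realType} {n : nat} {p : R}.

(* f in C_c^oo((0, T) x R^n), extended by 0 to R x R^n. *)
Definition test_function (T : R) (f : R * 'rV[R]_n -> R) : Prop :=
  let supp := closure [set z | f z != 0] in
  [/\ smooth f, compact supp & supp `<=` [set z | 0 < z.1 < T]].

Definition dtime (f : R * 'rV[R]_n -> R) (t : R) (x : 'rV[R]_n) : R :=
  derive1 (fun s => f (s, x)) t.

Definition grad (f : R * 'rV[R]_n -> R) (t : R) (x : 'rV[R]_n) : 'rV[R]_n :=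
  \row_i 'D_(delta_mx 0 i) (fun y => f (t, y)) x.

Definition is_solution (T : R) (v : Pp n p -> 'rV[R]_n -> 'rV[R]_n)
    (mu0 : Pp n p) (mu : R -> Pp n p) : Prop :=
  [/\ Ccurve T mu,
      forall t : R, t \in `[0, T] -> Pcac (mu t),
      measure_eq (mu 0) mu0 &
      forall f, test_function T f ->
        (\int[@lebesgue_measure R]_(t in [set` `[0, T]%R])
           \int[mu t]_x (dtime f t x + dotp (grad f t x) (v (mu t) x))%:E = 0)%E].

Definition is_flow (w : 'rV[R]_n -> 'rV[R]_n) (Phi : R -> 'rV[R]_n -> 'rV[R]_n) :
    Prop :=
  (forall x, Phi 0 x = x) /\
  (forall x (t : R), is_derive t 1 (fun s => Phi s x) (w (Phi t x))).

(* Semi-discrete Lagrangian scheme with N time steps. Under [hypH] the fields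
   v[mu_(i dt)] have a unique global flow, so that this determines mu_t up to
   [measure_eq] for every t in [0, T]. *)
Definition scheme1 (T : R) (v : Pp n p -> 'rV[R]_n -> 'rV[R]_n)
    (mu0 : Pp n p) (N : nat) (mu : R -> Pp n p) : Prop :=
  let dt := T / N%:R in
  measure_eq (mu 0) mu0 /\
  forall i : nat, (i < N)%N ->
    exists2 Phi, is_flow (v (mu (i%:R * dt))) Phi &
      forall t, t \in `[i%:R * dt, i.+1%:R * dt] ->
        measure_eq (mu t) (pushforward (mu (i%:R * dt)) (Phi (t - i%:R * dt))).

End cauchy_problem.

(* Main.v *)
(* All the measures mu^k_t are push-forwards X^k_t # mu0 of the initial datum by
   the composed flows of the scheme, and W_p (f # m, g # m) <= sup |f - g|. So
   everything is done on the maps X^k_t, with uniform distances, and neither the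
   triangle inequality of W_p nor the completeness of P_p is needed.
   A Gronwall argument, which closes because
   |v[f # mu0] - v[g # mu0]| <= K sup |f - g|, gives |X^k - X^m| = O(2^-k) for
   k <= m, hence a uniform limit X, and mubar_t := X_t # mu0. Passing to the limit in the mean value inequality
   for X^k yields
     |X_t - X_s - (t - s) v[mubar_s](X_s)| <= (K + L) M |t - s|^2,
   i.e. X is the flow of v[mubar]. The weak formulation is then the integral over
   [0, T] of the derivative of t |-> \int f(t, X_t x) dmu0, which vanishes at both
   ends. Absolute continuity survives because the X^k_t, and so X_t, satisfy
   |x - y| <= e^(LT) |X_t x - X_t y|, so that preimages of null sets are null. *)

From HB Require Import structures.
Require Import Defs.
From mathcomp Require Import all_boot all_order all_algebra.
From mathcomp Require Import all_classical all_reals all_analysis.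
From mathcomp Require Import measurable_realfun.
From mathcomp Require Import ring lra.

Set Implicit Arguments.
Unset Strict Implicit.
Unset Printing Implicit Defensive.

Import Order.TTheory GRing.Theory Num.Theory.
Import numFieldNormedType.Exports.

Local Open Scope classical_set_scope.
Local Open Scope ring_scope.

(** * The Euclidean norm *)

(** The velocity at a point depends on the whole measure, so the distance between two trajectories
    with the same start is controlled only through the supremum over all starting points. That
    supremum need not be differentiable in time. The Gronwall step is therefore not a differential
    inequality: a bound on the weighted supremum is shown to improve itself. This requires some
    finite bound to begin with, and the speed limit [M] supplies it. Velocities jump at the grid
    points. The estimates are phrased as relations between two times that compose, are proved inside
    one cell, and are then chained. The comparison of X^k with X^m for k <= m rests on the nesting
    of dyadic grids: on a cell of the finer grid both trajectories solve an autonomous equation. No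
    derivative of X^k is passed to the limit. The quadratic remainder is an inequality between
    values of the flow, hence stable under uniform convergence, and the limit is differentiated only
    afterwards. *)

Lemma near_dist_le {R : realType} {V : normedModType R} (x : V) (e : R) :
  0 < e -> \forall y \near x, `|x - y| <= e.
Proof.
move=> e0; apply/nbhs_ballP; exists e => // y; rewrite -ball_normE /= => xy.
exact: ltW.
Qed.

Lemma continuous_epsdelta {R : realType} {V W : normedModType R} (f : V -> W) :
  (forall x e, 0 < e -> exists2 d, 0 < d &
    forall y, `|x - y| <= d -> `|f x - f y| <= e) -> continuous f.
Proof.
move=> fe x; apply/cvgrPdist_le => e e0; have [d d0 df] := fe x e e0.
exact: filterS (near_dist_le x d0).
Qed.

Section euclidean.
Context {R : realType} {n : nat}.
Implicit Types u w x y z : 'rV[R]_n.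

Lemma dotpC u w : dotp u w = dotp w u.
Proof. by apply: eq_bigr => i _; rewrite mulrC. Qed.

Lemma dotp_linear u : linear (dotp u).
Proof.
move=> a x y; rewrite /dotp scaler_sumr -big_split; apply: eq_bigr => i _ /=.
by rewrite !mxE /GRing.scale /= mulrDr mulrCA.
Qed.

HB.instance Definition _ u :=
  GRing.isLinear.Build R 'rV[R]_n R _ (dotp u) (dotp_linear u).

Lemma dotpB u x y : dotp u (x - y) = dotp u x - dotp u y.
Proof. exact: linearB. Qed.

Lemma dotpN u x : dotp u (- x) = - dotp u x.
Proof. exact: linearN. Qed.

Lemma dotpBZ u x y (a b : R) :
  dotp u (a *: x - b *: y) = a * dotp u x - b * dotp u y.
Proof. by rewrite linearB /= !linearZ. Qed.

Lemma sqr_enorm x : enorm x ^+ 2 = dotp x x.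
Proof.
rewrite /enorm sqr_sqrtr; last by apply: sumr_ge0 => i _; exact: sqr_ge0.
by apply: eq_bigr => i _; rewrite expr2.
Qed.

Lemma enorm_ge0 x : 0 <= enorm x.
Proof. exact: sqrtr_ge0. Qed.

Lemma enormZ a x : enorm (a *: x) = `|a| * enorm x.
Proof.
rewrite /enorm -sqrtr_sqr -sqrtrM ?sqr_ge0// mulr_sumr.
by congr Num.sqrt; apply: eq_bigr => i _; rewrite mxE exprMn.
Qed.

Lemma enorm0 : enorm (0 : 'rV[R]_n) = 0.
Proof. by rewrite -(scale0r 0) enormZ normr0 mul0r. Qed.

Lemma enormN x : enorm (- x) = enorm x.
Proof. by rewrite -scaleN1r enormZ normrN1 mul1r. Qed.

Lemma edistC x y : enorm (x - y) = enorm (y - x).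
Proof. by rewrite -opprB enormN. Qed.

Lemma coord_le_enorm x i : `|x 0 i| <= enorm x.
Proof.
rewrite -sqrtr_sqr /enorm ler_sqrt; last by apply: sumr_ge0 => ? _; exact: sqr_ge0.
by rewrite (bigD1 i)//= lerDl; apply: sumr_ge0 => ? _; exact: sqr_ge0.
Qed.

Lemma enorm0_eq0 x : enorm x = 0 -> x = 0.
Proof.
move=> x0; apply/rowP => i; rewrite mxE; apply/eqP.
by rewrite -normr_le0 -x0; exact: coord_le_enorm.
Qed.

(** Cauchy-Schwarz: with a = |u| and b = |w|, expanding |b u - a w|^2 >= 0 gives 2ab(ab - u.w) >= 0,
    and ab > 0 once zero vectors are set aside. *)
Lemma dotp_le_enorm u w : dotp u w <= enorm u * enorm w.
Proof.
have [->|u0] := eqVneq u 0; first by rewrite dotpC linear0 enorm0 mul0r.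
have [->|w0] := eqVneq w 0; first by rewrite linear0 enorm0 mulr0.
have pos z : z != 0 -> 0 < enorm z.
  by move=> z0; rewrite lt_def enorm_ge0 andbT; apply: contra_neq z0 => /enorm0_eq0.
set a := enorm u; set b := enorm w.
have : 0 <= dotp (b *: u - a *: w) (b *: u - a *: w).
  by rewrite -sqr_enorm sqr_ge0.
rewrite dotpBZ dotpC dotpBZ [dotp (_ - _) w]dotpC dotpBZ [dotp w u]dotpC -!sqr_enorm.
rewrite -/a -/b => h.
have ab : 0 < a * b by rewrite mulr_gt0 ?pos.
rewrite -(ler_pM2l ab); rewrite -subr_ge0; nra.
Qed.

Lemma enormD x y : enorm (x + y) <= enorm x + enorm y.
Proof.
rewrite -(@ler_pXn2r _ 2) ?nnegrE ?addr_ge0 ?enorm_ge0//.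
rewrite sqrrD !sqr_enorm linearD /= dotpC linearD /=.
rewrite [dotp (x + y) y]dotpC linearD /= [dotp y x]dotpC.
have := dotp_le_enorm x y; lra.
Qed.

Lemma enormB_triangle z x y : enorm (x - y) <= enorm (x - z) + enorm (z - y).
Proof. by rewrite -[x - y](subrKA z) enormD. Qed.

Lemma norm_le_enorm x : `|x| <= enorm x.
Proof.
rewrite [leLHS]/Num.Def.normr/= mx_normrE (bigmax_le _ (enorm_ge0 x))//= => -[i j] _.
by rewrite ord1 coord_le_enorm.
Qed.

Lemma coord_le_norm x i : `|x 0 i| <= `|x|.
Proof.
rewrite [leRHS]/Num.Def.normr/= mx_normrE.
exact: (le_bigmax _ (fun ij => `|x ij.1 ij.2|) (0, i)).
Qed.

Lemma enorm_le_norm x : enorm x <= n%:R * `|x|.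
Proof.
rewrite -[leRHS]ger0_norm; last by rewrite mulr_ge0.
rewrite -sqrtr_sqr ler_sqrt ?sqr_ge0// exprMn.
apply: (@le_trans _ _ (\sum_(i < n) `|x| ^+ 2)).
  apply: ler_sum => i _; rewrite -[leLHS]ger0_norm ?sqr_ge0// normrX.
  by rewrite ler_pXn2r ?nnegrE//; exact: coord_le_norm.
rewrite sumr_const card_ord -[leLHS]mulr_natl ler_wpM2r ?sqr_ge0//.
by rewrite expr2 -natrM ler_nat; case: (n) => // k; rewrite leq_pmull.
Qed.

Lemma coord_continuous_row i : continuous (fun x => x 0 i).
Proof.
exact: coord_continuous.
Qed.

Lemma dotp_continuous u : continuous (dotp u).
Proof.
apply: (continuous_big (@add_continuous R)) => i _ x.
by apply: continuousM; [exact: cst_continuous|exact: coord_continuous_row].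
Qed.

Lemma enorm_continuous : continuous (enorm : 'rV[R]_n -> R).
Proof.
move=> x; apply: (@continuous_comp _ _ _ _ (@Num.sqrt R)); last exact: sqrt_continuous.
apply: (continuous_big (@add_continuous R)) => i _ {}x.
apply: (@continuous_comp _ _ _ _ (fun r : R => r ^+ 2)).
  exact: coord_continuous_row.
exact: exprn_continuous.
Qed.

Lemma elipschitz_continuous (f : 'rV[R]_n -> 'rV[R]_n) (C : R) :
  (forall x y, enorm (f x - f y) <= C * enorm (x - y)) -> continuous f.
Proof.
move=> Cf; apply: continuous_epsdelta => x e e0.
(* The added ones keep both denominators positive when [C] is not positive or [n] is 0. *)
have e1 : 0 < e / (`|C| + 1) / (n%:R + 1).
  by rewrite !divr_gt0// ltr_wpDl.
exists (e / (`|C| + 1) / (n%:R + 1)) => // y xy.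
apply: (le_trans (norm_le_enorm _)); apply: (le_trans (Cf _ _)).
apply: (@le_trans _ _ ((`|C| + 1) * ((n%:R + 1) * (e / (`|C| + 1) / (n%:R + 1))))); last first.
  rewrite le_eqVlt; apply/orP; left; apply/eqP; field.
  by rewrite !gt_eqF ?ltr_wpDl.
apply: (@le_trans _ _ ((`|C| + 1) * enorm (x - y))).
  by rewrite ler_wpM2r ?enorm_ge0// (le_trans (ler_norm _))// lerDl.
rewrite ler_wpM2l ?addr_ge0//; apply: (le_trans (enorm_le_norm _)).
by apply: ler_pM => //; rewrite lerDl.
Qed.

End euclidean.

(** * Wasserstein bounds *)

Section borel_measurability.
Context {R : realType} {m n m' n' : nat}.

Lemma continuous_measurable_mx (f : 'M[R]_(m, n) -> 'M[R]_(m', n')) :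
  continuous f -> measurable_fun setT f.
Proof.
move=> /continuousP cf; apply: (measurability (@open 'M[R]_(m', n'))) => //.
move=> _ [A oA <-]; rewrite setTI; apply: sub_sigma_algebra; exact: cf.
Qed.

Lemma continuous_measurable_mxr (f : 'M[R]_(m, n) -> R) :
  continuous f -> measurable_fun setT f.
Proof.
move=> /continuousP cf.
apply: (measurability _ (RGenOpens.measurableE R)).
move=> _ [_ [a [b ->] <-]]; rewrite setTI; apply: sub_sigma_algebra.
exact/cf/interval_open.
Qed.

Lemma open_measurable_mx (A : set 'M[R]_(m, n)) : open A -> measurable A.
Proof. exact: sub_sigma_algebra. Qed.

End borel_measurability.

Lemma measurable_EFin_powR {R : realType} {p : R} d (T : measurableType d)
    (f : T -> R) : measurable_fun setT f ->
  measurable_fun setT (fun x => (f x `^ p)%:E).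
Proof.
by move=> mf; apply/measurable_EFinP; apply: (@measurableT_comp _ _ _ _ _ _ (@powR R ^~ p)).
Qed.

Section wasserstein_bounds.
Context {R : realType} {n : nat} {p : R}.
Hypothesis p0 : 0 < p.
Local Notation V := 'rV[R]_n.

Lemma measurable_enorm : measurable_fun setT (enorm : V -> R).
Proof. apply: continuous_measurable_mxr; exact: enorm_continuous. Qed.

(** The pairs carry the product sigma-algebra, which is not by definition the Borel one of the
    product topology, so continuity does not apply directly. The distance is rewritten through
    coordinates, each a measurable function of one projection. *)
Lemma measurable_enormB :
  measurable_fun setT (fun z : V * V => enorm (z.1 - z.2)).
Proof.
rewrite (_ : (fun _ => _) = fun z : V * V =>
   Num.sqrt (\sum_(i < n) (z.1 0 i - z.2 0 i) ^+ 2)); last first.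
  by apply/funext => z; congr Num.sqrt; apply: eq_bigr => i _; rewrite !mxE.
apply: (@measurableT_comp _ _ _ _ _ _ (@Num.sqrt R)).
  apply: continuous_measurable_fun; exact: sqrt_continuous.
apply: measurable_sum => i; apply: measurable_funX.
apply: measurable_funB.
  apply: (@measurableT_comp _ _ _ _ _ _ (fun x : V => x 0 i)) => //.
  by apply: continuous_measurable_mxr; exact: coord_continuous_row.
apply: (@measurableT_comp _ _ _ _ _ _ (fun x : V => x 0 i)) => //.
by apply: continuous_measurable_mxr; exact: coord_continuous_row.
Qed.

Lemma Wp_ge0 (mu nu : Pp n p) : (0 <= Wp mu nu)%E.
Proof. by apply: le_ereal_inf_tmp => _ [pi _ <-]; exact: poweR_ge0. Qed.

Lemma measurable_fun_mfun d d' (T : measurableType d) (T' : measurableType d') (f : T -> T') :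
  measurable_fun setT f -> exists g : {mfun T >-> T'}, g = f :> (T -> T').
Proof.
move=> mf.
by exists (HB.pack_for {mfun T >-> T'} f (isMeasurableFun.Build _ _ _ _ f mf)).
Qed.

Lemma pushforward_probability d d' (T : measurableType d) (T' : measurableType d')
    (P : probability T R) (f : T -> T') : measurable_fun setT f ->
  exists Q : probability T' R, Q = pushforward P f :> (set T' -> \bar R).
Proof. by move=> /measurable_fun_mfun[g <-]; exists (distribution P g). Qed.

Lemma ge0_integral_pushforward_eq d d' (T : measurableType d)
    (T' : measurableType d') (P : probability T R) (Q : probability T' R)
    (f : T -> T') (h : T' -> \bar R) : measurable_fun setT f ->
  Q = pushforward P f :> (set T' -> \bar R) ->
  measurable_fun setT h -> (forall y, 0 <= h y)%E ->
  (\int[Q]_y h y = \int[P]_x h (f x))%E.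
Proof.
move=> mf QE mh h0.
rewrite (@eq_measure_integral _ _ _ _ (pushforward P f)); last first.
  by move=> A mA _; exact: (congr1 (fun m => m A) QE).
by rewrite (ge0_integral_pushforward mf).
Qed.

(** The image of [m] under x |-> (f x, g x) is a coupling, and its cost is the integral of |f - g|^p
    against a probability, at most c^p. *)
Lemma Wp_le_dist (m : probability V R) (f g : V -> V) (mu nu : Pp n p) (c : R) :
  measurable_fun setT f -> measurable_fun setT g ->
  measure_eq mu (pushforward m f) -> measure_eq nu (pushforward m g) ->
  0 <= c -> (forall x, enorm (f x - g x) <= c) -> (Wp mu nu <= c%:E)%E.
Proof.
move=> mf mg muE nuE c0 fgc.
have mfg : measurable_fun setT (fun x => (f x, g x)) by exact: measurable_fun_pair.
have [Q QE] := pushforward_probability m mfg.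
apply: (@le_trans _ _ (poweR (\int[Q]_z ((enorm (z.1 - z.2)) `^ p)%:E) p^-1)).
  apply: ereal_inf_lbound; exists Q => //; split => A mA.
    by rewrite muE//; exact: (congr1 (fun m => m (fst @^-1` A)) QE).
  by rewrite nuE//; exact: (congr1 (fun m => m (snd @^-1` A)) QE).
have mh : measurable_fun setT (fun z : V * V => ((enorm (z.1 - z.2)) `^ p)%:E).
  by apply: measurable_EFin_powR; exact: measurable_enormB.
rewrite (ge0_integral_pushforward_eq mfg QE mh); last first.
  by move=> z; rewrite lee_fin powR_ge0.
apply: (@le_trans _ _ (poweR (c `^ p)%:E p^-1)); last first.
  by rewrite poweR_EFin -powRrM divff ?gt_eqF// powRr1.
apply: gt0_ler_poweR; first by rewrite invr_ge0 ltW.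
- by rewrite in_itv/= leey andbT; apply: integral_ge0 => z _; rewrite lee_fin powR_ge0.
- by rewrite in_itv/= leey andbT lee_fin powR_ge0.
apply: (@le_trans _ _ (\int[m]_x (cst (c `^ p)%:E x))%E).
  apply: ge0_le_integral => //.
  - by move=> x _; rewrite lee_fin powR_ge0.
  - exact: (measurableT_comp mh mfg).
  - move=> x _ /=; rewrite lee_fin ge0_ler_powR ?nnegrE ?enorm_ge0//; exact: ltW.
by rewrite integral_cst//= probability_setT mule1.
Qed.

(** A bounded displacement keeps the moment finite: |f x| <= |x| + C <= 2 max(|x|, C), so |f x|^p <=
    2^p (|x|^p + C^p). *)
Lemma Pp_pushforward (mu0 : Pp n p) (f : V -> V) (C : R) :
  measurable_fun setT f -> (forall x, enorm (f x - x) <= C) ->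
  exists mu : Pp n p, mu = pushforward mu0 f :> (set V -> \bar R).
Proof.
move=> mf fC; have [Q QE] := pushforward_probability mu0 mf.
have C0 : 0 <= C by exact: le_trans (enorm_ge0 _) (fC 0).
have mp : measurable_fun setT (fun x : V => ((enorm x) `^ p)%:E).
  by apply: measurable_EFin_powR; exact: measurable_enorm.
suff mom : (\int[Q]_x ((enorm x) `^ p)%:E < +oo)%E by exists (MkPp mom).
rewrite (ge0_integral_pushforward_eq mf QE mp); last first.
  by move=> z; rewrite lee_fin powR_ge0.
apply: (@le_lt_trans _ _ (\int[mu0]_x
    ((2 `^ p)%:E * (((enorm x) `^ p)%:E + cst (C `^ p)%:E x)))%E).
  apply: ge0_le_integral => //.
  - by move=> x _; rewrite lee_fin powR_ge0.
  - exact: (measurableT_comp mp mf).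
  - apply: measurable_funeM; exact: emeasurable_funD.
  - move=> x _ /=; rewrite -EFinD -EFinM lee_fin.
    have fx : enorm (f x) <= 2 * Num.max (enorm x) C.
      apply: (@le_trans _ _ (enorm x + C)).
        by have := enormD (f x - x) x; have := fC x; rewrite subrK; lra.
      by rewrite mulr_natl mulr2n lerD// le_max lexx ?orbT.
    apply: (@le_trans _ _ ((2 * Num.max (enorm x) C) `^ p)).
      rewrite ge0_ler_powR ?nnegrE ?enorm_ge0 ?(ltW p0)//.
      by rewrite mulr_ge0// le_max enorm_ge0.
    rewrite powRM ?le_max ?enorm_ge0//.
    rewrite ler_wpM2l ?powR_ge0//.
    by have [_|_] := leP (enorm x) C; rewrite ?lerDr ?lerDl powR_ge0.
rewrite ge0_integralZl//=; last 2 first.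
- exact: emeasurable_funD.
- by move=> x _; rewrite -EFinD lee_fin addr_ge0 ?powR_ge0.
rewrite ge0_integralD//=; last 2 first.
- by move=> x _; rewrite lee_fin powR_ge0.
- by move=> x _; rewrite lee_fin powR_ge0.
rewrite integral_cst//= probability_setT mule1.
by rewrite lte_mul_pinfty ?lee_fin ?powR_ge0// lte_add_pinfty ?ltry// Pp_moment.
Qed.

End wasserstein_bounds.

(** * Mean value and Gronwall inequalities *)

Section curves.
Context {R : realType} {n : nat}.
Local Notation V := 'rV[R]_n.
Implicit Types (g dg : R -> V) (f df psi dpsi : R -> R) (a b t c L : R).

Lemma is_derive_cvg (W : normedModType R) (g : R -> W) (t : R) (w : W) :
  is_derive t 1 g w ->
  (fun h : R => h^-1 *: (g (h + t) - g t)) @ 0^' --> w.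
Proof.
move=> [dg gw]; rewrite -[w]gw.
rewrite (_ : (fun h : R => _) = (fun h => h^-1 *: (g (h *: 1 + t) - g t))).
  exact: dg.
by apply/funext => h; rewrite scaler1.
Qed.

Lemma cvg_is_derive (W : normedModType R) (g : R -> W) (t : R) (w : W) :
  (fun h : R => h^-1 *: (g (h + t) - g t)) @ 0^' --> w -> is_derive t 1 g w.
Proof.
rewrite (_ : (fun h : R => _) = (fun h => h^-1 *: (g (h *: 1 + t) - g t))); last first.
  by apply/funext => h; rewrite scaler1.
move=> gw; apply: DeriveDef; first by apply/cvg_ex; exists w.
exact: cvg_lim gw.
Qed.

Lemma is_derive_dotp (u : V) g t (w : V) :
  is_derive t 1 g w -> is_derive t 1 (fun s => dotp u (g s)) (dotp u w).
Proof.
move=> /is_derive_cvg dg; apply: cvg_is_derive.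
rewrite (_ : (fun h : R => _) = dotp u \o (fun h => h^-1 *: (g (h + t) - g t))).
  by apply: (cvg_comp _ _ dg); exact: dotp_continuous.
by apply/funext => h /=; rewrite linearZ /= dotpB.
Qed.

Lemma is_derive_sqr_enorm g t (w : V) :
  is_derive t 1 g w ->
  is_derive t 1 (fun s => dotp (g s) (g s)) (2 * dotp (g t) w).
Proof.
move=> dg.
have dgi i : is_derive t 1 (fun s => g s 0 i) (w 0 i).
  have coordE x : dotp (delta_mx 0 i) x = x 0 i.
    rewrite /dotp (bigD1 i)//= mxE !eqxx mul1r big1 ?addr0// => j ji.
    by rewrite mxE (negbTE ji) mul0r.
  have := is_derive_dotp (delta_mx 0 i) dg; rewrite coordE.
  by rewrite (_ : (fun s => dotp _ _) = fun s => g s 0 i)//; apply/funext => s.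
rewrite (_ : (fun s => _) = \sum_(i < n) (fun s => g s 0 i) * (fun s => g s 0 i)).
  have := is_derive_sum (fun i => is_deriveM (dgi i) (dgi i)).
  congr is_derive; rewrite /dotp mulr_sumr; apply: eq_bigr => i _.
  by rewrite /GRing.scale /= [2 * _]mulr_natl mulr2n.
by apply/funext => s; rewrite fct_sumE.
Qed.

Lemma is_derive_ndecr f df a b : a <= b ->
  (forall t, is_derive t 1 f (df t)) -> (forall t, a <= t <= b -> 0 <= df t) ->
  f a <= f b.
Proof.
move=> ab fdf df0.
have [|c cab fE] := @MVT_segment _ f df a b ab (fun t _ => fdf t).
  apply: continuous_subspaceT => x; apply: differentiable_continuous.
  by apply/derivable1_diffP; have [] := fdf x.
by rewrite -subr_ge0 fE mulr_ge0 ?subr_ge0// df0// -in_itv.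
Qed.

(** Projecting on u = g b - g a reduces to scalars: |u| psi - u.g is nondecreasing by
    Cauchy-Schwarz, so |u|^2 <= |u| (psi b - psi a). When u = 0 there is nothing to divide by, and
    the claim is the monotonicity of psi. A general majorant psi, rather than a constant speed,
    allows exponential weights later. *)
Lemma enorm_mean_value g dg psi dpsi a b : a <= b ->
  (forall t, is_derive t 1 g (dg t)) -> (forall t, is_derive t 1 psi (dpsi t)) ->
  (forall t, a <= t <= b -> enorm (dg t) <= dpsi t) ->
  enorm (g b - g a) <= psi b - psi a.
Proof.
move=> ab gdg pdp dgp; set u := g b - g a.
have h0 t : is_derive t 1 (fun s => enorm u * psi s - dotp u (g s))
    (enorm u * dpsi t - dotp u (dg t)).
  have h1 := is_derive_dotp u (gdg t).
  have h2 : is_derive t 1 (enorm u \*: psi) (enorm u *: dpsi t).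
    exact: is_deriveZ.
  exact: is_deriveB.
have h3 : enorm u * psi a - dotp u (g a) <= enorm u * psi b - dotp u (g b).
  apply: (is_derive_ndecr ab h0) => t /dgp dgt; rewrite subr_ge0 (le_trans (dotp_le_enorm _ _))//.
  by rewrite ler_wpM2l// enorm_ge0.
have : dotp u (g b) - dotp u (g a) = enorm u ^+ 2.
  by rewrite -dotpB -sqr_enorm.
move=> uE; have h4 : enorm u * enorm u <= enorm u * (psi b - psi a) by nra.
have [u0|u0] := eqVneq (enorm u) 0; last first.
  have up : 0 < enorm u by rewrite lt_def u0 enorm_ge0.
  by rewrite -(ler_pM2l up).
rewrite u0 subr_ge0; apply: (is_derive_ndecr ab pdp) => t /dgp.
exact/le_trans/enorm_ge0.
Qed.

Lemma is_derive_expRM c t : is_derive t 1 (fun s : R => expR (c * s)) (c * expR (c * t)).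
Proof.
have h : is_derive t 1 (c \*: (@idfun R)) (c *: 1).
  exact: is_deriveZ.
have := @is_derive1_comp _ expR (c \*: (@idfun R)) t _ _ (is_derive_expR _) h.
by rewrite /GRing.scale /= mulr1 mulrC.
Qed.

(** The square (|g| e^(ct))^2 is differentiated, because the norm itself is not differentiable where
    [g] vanishes. *)
Lemma enorm_growth g dg c a b : a <= b ->
  (forall t, is_derive t 1 g (dg t)) ->
  (forall t, a <= t <= b -> 0 <= dotp (g t) (dg t) + c * enorm (g t) ^+ 2) ->
  enorm (g a) * expR (c * a) <= enorm (g b) * expR (c * b).
Proof.
move=> ab gdg h.
have h0 t : is_derive t 1
    ((fun s => dotp (g s) (g s)) * (fun s => expR (2 * c * s)))
    (dotp (g t) (g t) *: (2 * c * expR (2 * c * t)) +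
     expR (2 * c * t) *: (2 * dotp (g t) (dg t))).
  apply: is_deriveM; first exact: is_derive_sqr_enorm.
  exact: is_derive_expRM.
have : ((fun s => dotp (g s) (g s)) * (fun s => expR (2 * c * s))) a <=
    ((fun s => dotp (g s) (g s)) * (fun s => expR (2 * c * s))) b.
  apply: (is_derive_ndecr ab h0) => t /h ht; rewrite /GRing.scale /= -sqr_enorm.
  have := expR_gt0 (2 * c * t); nra.
have e2 t : ((fun s => dotp (g s) (g s)) * (fun s => expR (2 * c * s))) t =
    (enorm (g t) * expR (c * t)) ^+ 2.
  by rewrite exprMn sqr_enorm -expRM_natl mulrA.
by rewrite !e2 ler_pXn2r// nnegrE mulr_ge0 ?enorm_ge0 ?expR_ge0.
Qed.

(** The second bound is [enorm_growth] with c = L. The first is the same statement for the reversed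
    curve s |-> g (-s) on [-b, -a]. Both directions are kept because the backward one makes the flow
    maps inverse-Lipschitz. *)
Lemma enorm_gronwall g dg L a b : a <= b ->
  (forall t, is_derive t 1 g (dg t)) ->
  (forall t, a <= t <= b -> enorm (dg t) <= L * enorm (g t)) ->
  enorm (g b) <= expR (L * (b - a)) * enorm (g a) /\
  enorm (g a) <= expR (L * (b - a)) * enorm (g b).
Proof.
move=> ab gdg h; split.
  pose g' t := g (- t); pose dg' t := - dg (- t).
  have gdg' t : is_derive t 1 g' (dg' t).
    apply: cvg_is_derive.
    have := is_derive_cvg (gdg (- t)) => dgt.
    rewrite /dg' (_ : (fun h0 : R => _) =
        -%R \o ((fun h => h^-1 *: (g (h + (- t)) - g (- t))) \o -%R)).
      apply: cvgN; apply: cvg_comp dgt.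
      move=> A [e /= e0 eA]; exists e => // x /=.
      rewrite sub0r normrN => xe x0; apply: eA; rewrite /= ?sub0r ?opprK//.
      by rewrite oppr_eq0.
    by apply/funext => x /=; rewrite /g' opprD invrN scaleNr opprK.
  have hb : enorm (g' (- b)) * expR (L * (- b)) <= enorm (g' (- a)) * expR (L * (- a)).
    apply: (enorm_growth _ gdg'); rewrite ?lerN2// => t /andP[bt ta].
    have := h (- t); rewrite lerNl lerNr ta bt => /(_ isT) ht.
    have := dotp_le_enorm (g (- t)) (dg (- t)).
    rewrite /g' /dg' dotpN => hd; have := enorm_ge0 (g (-t)); nra.
  rewrite /g' !opprK !mulrN in hb.
  rewrite -(ler_pM2r (expR_gt0 (- (L * b)))) (le_trans hb)// mulrAC -expRD.
  by rewrite mulrC mulrBr addrAC subrr add0r.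
have hb : enorm (g a) * expR (L * a) <= enorm (g b) * expR (L * b).
  apply: (enorm_growth ab gdg) => t /h ht; have := dotp_le_enorm (- g t) (dg t).
  rewrite dotpC dotpN dotpC enormN => hd; have := enorm_ge0 (g t); nra.
rewrite -(ler_pM2r (expR_gt0 (L * a))) (le_trans hb)// mulrAC -expRD.
by rewrite mulrC mulrBr subrK.
Qed.

End curves.

(** * Trajectories of the scheme *)

Section velocity_bounds.
Context {R : realType} {n : nat} {p : R}.
Local Notation V := 'rV[R]_n.

(** Hypothesis (H) with the extended-real distance and sup norm replaced by a real bound [c] and a
    single point, so that the estimates below are inequalities between reals. *)
Definition lipschitz_velocity (v : Pp n p -> V -> V) (L M K : R) : Prop :=
  [/\ forall mu x y, enorm (v mu x - v mu y) <= L * enorm (x - y),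
      forall mu x, enorm (v mu x) <= M &
      forall mu nu x c, (Wp mu nu <= c%:E)%E -> enorm (v mu x - v nu x) <= K * c].

Lemma hypH_lipschitz (v : Pp n p -> V -> V) : hypH v ->
  exists L M K : R, [/\ 0 < L, 0 < M, 0 < K & lipschitz_velocity v L M K].
Proof.
case=> _ [L [M [K [vL vM vK]]]].
have lt0 (a : R) : 0 < `|a| + 1 by rewrite ltr_wpDl.
(* The constants of (H) carry no sign. Raising each to [|.| + 1] makes it positive and weakens the
   bounds. *)
have le1 (a : R) : a <= `|a| + 1 by rewrite (le_trans (ler_norm _))// lerDl.
exists (`|L| + 1), (`|M| + 1), (`|K| + 1); split => //; split.
- by move=> mu x y; rewrite (le_trans (vL _ _ _))// ler_wpM2r ?enorm_ge0.
- by move=> mu x; rewrite (le_trans (vM _ _)).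
- move=> mu nu x c Wc; rewrite -lee_fin EFinM.
  apply: (@le_trans _ _ (C0norm (fun x => v mu x - v nu x))).
    by apply: ereal_sup_ubound; exists x.
  apply: (le_trans (vK mu nu)).
  apply: (@le_trans _ _ ((`|K| + 1)%:E * Wp mu nu)%E).
    by apply: lee_wpmul2r; [exact: Wp_ge0|rewrite lee_fin].
  by apply: lee_wpmul2l => //; rewrite lee_fin ltW.
Qed.

End velocity_bounds.

(** * Chaining estimates along a time grid *)

Section grids.
Context {R : realType}.
Implicit Types (s t dt : R) (N : nat).

(** This is the way past the grid points, where trajectories may have a corner: a relation between
    two times that is reflexive and composes needs proof only inside one closed cell. *)
Lemma grid_chain (P : R -> R -> Prop) N dt : 0 <= dt ->
  (forall s, P s s) ->
  (forall s t u, s <= t -> t <= u -> P s t -> P t u -> P s u) ->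
  (forall i s t, (i < N)%N -> i%:R * dt <= s -> s <= t -> t <= i.+1%:R * dt ->
    P s t) ->
  forall s t, 0 <= s -> s <= t -> t <= N%:R * dt -> P s t.
Proof.
move=> dt0 Pxx Ptr; elim: N => [_ s t s0 st|N IH Pc s t s0 st tN].
  rewrite mul0r => t0; have -> : s = t by apply/eqP; rewrite eq_le st (le_trans t0).
  exact: Pxx.
have Pc' i s' t' : (i < N)%N -> i%:R * dt <= s' -> s' <= t' -> t' <= i.+1%:R * dt ->
  P s' t' by move=> iN; apply: Pc; exact: ltnW.
have [tN'|Nt] := leP t (N%:R * dt); first exact: IH.
have [Ns|sN] := leP (N%:R * dt) s; first exact: (Pc N).
apply: (Ptr _ (N%:R * dt)); rewrite ?(ltW sN) ?(ltW Nt)//.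
  by apply: IH => //; exact: ltW.
by apply: (Pc N) => //; exact: ltW.
Qed.

Lemma grid_cell N dt t : (0 < N)%N -> 0 <= t -> t <= N%:R * dt ->
  exists2 i, (i < N)%N & i%:R * dt <= t <= i.+1%:R * dt.
Proof.
elim: N => // N IH _ t0 tN.
have [Nt|tN'] := leP (N%:R * dt) t; first by exists N => //; rewrite Nt.
case: N IH tN' {tN} => [|N IH tN]; first by rewrite mul0r ltNge t0.
by have [//|//||i iN ti] := IH; [exact: ltW|exists i => //; exact: ltnW].
Qed.

End grids.

Section flows.
Context {R : realType} {n : nat}.
Local Notation V := 'rV[R]_n.

Lemma is_derive_shift (g : R -> V) (t a : R) (w : V) :
  is_derive (t - a) 1 g w -> is_derive t 1 (fun s => g (s - a)) w.
Proof.
move=> /is_derive_cvg dg; apply: cvg_is_derive.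
by under eq_fun do rewrite -addrA.
Qed.

Lemma flow_lipschitz (w : V -> V) (Phi : R -> V -> V) (L t : R) :
  (forall x y, enorm (w x - w y) <= L * enorm (x - y)) -> is_flow w Phi ->
  0 <= t -> forall x y,
  enorm (Phi t x - Phi t y) <= expR (L * t) * enorm (x - y) /\
  enorm (x - y) <= expR (L * t) * enorm (Phi t x - Phi t y).
Proof.
move=> wL [Phi0 dPhi] t0 x y.
have := @enorm_gronwall _ _ (fun s => Phi s x - Phi s y)
  (fun s => w (Phi s x) - w (Phi s y)) L 0 t t0.
rewrite subr0 !Phi0; by apply => s _; exact: wL.
Qed.

End flows.

Section lagrangian_flow.
Context {R : realType} {n : nat} {p : R}.
Local Notation V := 'rV[R]_n.
Variables (T : R) (v : Pp n p -> V -> V) (mu0 : Pp n p) (L M K : R).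
Hypotheses (p_gt0 : 0 < p) (T_gt0 : 0 < T) (L_gt0 : 0 < L) (M_gt0 : 0 < M)
  (K_gt0 : 0 < K) (vLMK : lipschitz_velocity v L M K).

Let vL := let: And3 h _ _ := vLMK in h.

(* On each cell the trajectory extends to a curve solving the equation for all
   times, which spares one-sided derivatives at the grid points. *)
Definition lagrangian_flow (N : nat) (mu : R -> Pp n p) (X : R -> V -> V) : Prop :=
  let dt := T / N%:R in
  [/\ forall x, X 0 x = x,
      forall i (x : V), (i < N)%N -> exists2 Y : R -> V,
        (forall t : R, is_derive t 1 Y (v (mu (i%:R * dt)) (Y t))) &
        (forall t : R, i%:R * dt <= t <= i.+1%:R * dt -> X t x = Y t),
      forall t : R, 0 <= t <= T -> exists C : R,
        forall x y, enorm (X t x - X t y) <= C * enorm (x - y) &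
      forall t : R, 0 <= t <= T -> measure_eq (mu t) (pushforward mu0 (X t))].

Lemma scheme1_lagrangian_flow N mu : (0 < N)%N -> scheme1 T v mu0 N mu ->
  exists X, lagrangian_flow N mu X.
Proof.
move=> N0 [mu00 sch].
pose dt := T / N%:R; rewrite -/dt in sch.
have dt0 : 0 < dt by rewrite divr_gt0// ltr0n.
have NT : N%:R * dt = T by rewrite /dt mulrC divfK// pnatr_eq0 -lt0n.
(* Choice ranges over all indices, so a dummy identity flow is supplied beyond the last cell. *)
have /choice[Phi PhiP] : forall i, exists Phi : R -> V -> V, (i < N)%N ->
    is_flow (v (mu (i%:R * dt))) Phi /\
    forall t, t \in `[i%:R * dt, i.+1%:R * dt] ->
        measure_eq (mu t) (pushforward (mu (i%:R * dt)) (Phi (t - i%:R * dt))).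
  move=> i; have [iN|Ni] := boolP (i < N)%N; last by exists (fun _ => id).
  by have [Phi h1 h2] := sch i iN; exists Phi.
pose fix G i : V -> V := if i is j.+1 then Phi j dt \o G j else id.
(* [G i] is the flow after [i] full steps. At t = T the truncated quotient is [N], which indexes no
   cell, and the value is [G N x]. *)
pose X t x := let i := Num.truncn (t / dt) in
  if (i < N)%N then Phi i (t - i%:R * dt) (G i x) else G N x.
have Phi0 i x : (i < N)%N -> Phi i 0 x = x by move=> /PhiP[[]].
have dtE i : i.+1%:R * dt - i%:R * dt = dt.
  by rewrite -mulrBl -[i.+1]addn1 natrD [_ + 1]addrC addrK mul1r.
(* The formula of cell [i] also holds at its right end, where [X] is defined by the next cell: that
   flow is then at time 0, or the end T is reached, and both give [G i.+1 x]. *)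
have XE i t x : (i < N)%N -> i%:R * dt <= t <= i.+1%:R * dt ->
    X t x = Phi i (t - i%:R * dt) (G i x).
  move=> iN /andP[it]; rewrite le_eqVlt => /predU1P[->|ti].
    have -> : X (i.+1%:R * dt) x = G i.+1 x.
      rewrite /X mulfK ?gt_eqF// natrK.
      case: ltnP => [i1N|]; first by rewrite subrr Phi0.
      by rewrite leq_eqVlt ltnS leqNgt iN orbF => /eqP ->.
    by rewrite dtE.
  by rewrite /X (@truncn_def _ _ i) ?iN// ler_pdivlMr// ltr_pdivrMr// it.
have GL i : (i <= N)%N -> exists2 C, 0 <= C &
    forall x y, enorm (G i x - G i y) <= C * enorm (x - y).
  elim: i => [_|i IH iN]; first by exists 1 => // x y; rewrite mul1r.
  have [C C0 CG] := IH (ltnW iN).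
  exists (expR (L * dt) * C) => [|x y]; first by rewrite mulr_ge0// expR_ge0.
  have [flP _] := PhiP i iN.
  have [+ _] := flow_lipschitz (vL _) flP (ltW dt0) (G i x) (G i y).
  by move=> /le_trans; apply; rewrite -mulrA ler_wpM2l ?expR_ge0.
(* [measure_eq] speaks of measurable sets only, so every substitution under a preimage needs the
   flow maps to be measurable. *)
have PhiM i s : (i < N)%N -> 0 <= s -> measurable_fun setT (Phi i s).
  move=> iN s0; apply: continuous_measurable_mx.
  apply: (@elipschitz_continuous _ _ _ (expR (L * s))) => x y.
  have [flP _] := PhiP i iN.
  by have [fl _] := flow_lipschitz (vL _) flP s0 x y; exact: fl.
have muG i : (i <= N)%N -> measure_eq (mu (i%:R * dt)) (pushforward mu0 (G i)).
  elim: i => [_|i IH iN] A mA; first by rewrite mul0r mu00.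
  have [_ muP] := PhiP i iN.
  have iin : i.+1%:R * dt \in `[i%:R * dt, i.+1%:R * dt].
    by rewrite in_itv/= lexx andbT -subr_ge0 dtE ltW.
  rewrite (muP _ iin _ mA) dtE /pushforward IH// 1?ltnW//.
  by rewrite -[X in measurable X]setTI; apply: PhiM => //; exact: ltW.
exists X; split.
- move=> x; rewrite (XE 0%N)// ?mul0r ?lexx ?mul1r ?ltW//.
  by rewrite subrr Phi0.
- move=> i x iN; have [[_ flP] _] := PhiP i iN.
  exists (fun t => Phi i (t - i%:R * dt) (G i x)) => [t|t ti]; last exact: XE.
  exact: (@is_derive_shift _ _ (fun s => Phi i s (G i x))).
- move=> t /andP[t0 tT]; have [|i iN ti] := @grid_cell _ N dt t N0 t0; first by rewrite NT.
  have [C C0 CG] := GL i (ltnW iN); have /andP[it _] := ti.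
  exists (expR (L * (t - i%:R * dt)) * C) => x y; rewrite !(XE i)//.
  have [flP _] := PhiP i iN.
  have ti0 : 0 <= t - i%:R * dt by rewrite subr_ge0.
  have [+ _] := flow_lipschitz (vL _) flP ti0 (G i x) (G i y).
  by move=> /le_trans; apply; rewrite -mulrA ler_wpM2l ?expR_ge0.
- move=> t /andP[t0 tT] A mA.
  have [|i iN ti] := @grid_cell _ N dt t N0 t0; first by rewrite NT.
  have [_ muP] := PhiP i iN; rewrite muP ?in_itv//=.
  rewrite /pushforward muG ?(ltnW iN)//; last first.
    rewrite -[X in measurable X]setTI; apply: PhiM => //.
    by rewrite subr_ge0; case/andP: ti.
  rewrite /pushforward; congr (mu0 _); apply/funext => x /=.
  by rewrite (XE i).
Qed.

End lagrangian_flow.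

(** * Estimates on the trajectories, uniform in the number of steps *)

Section lagrangian_flow_estimates.
Context {R : realType} {n : nat} {p : R}.
Local Notation V := 'rV[R]_n.
Variables (T : R) (v : Pp n p -> V -> V) (mu0 : Pp n p) (L M K : R).
Hypotheses (p_gt0 : 0 < p) (T_gt0 : 0 < T) (L_gt0 : 0 < L) (M_gt0 : 0 < M)
  (K_gt0 : 0 < K) (vLMK : lipschitz_velocity v L M K).

Let vL := let: And3 h _ _ := vLMK in h.
Let vM := let: And3 _ h _ := vLMK in h.
Let vK := let: And3 _ _ h := vLMK in h.

Definition transports (f : V -> V) (mu : Pp n p) : Prop :=
  measurable_fun setT f /\ measure_eq mu (pushforward mu0 f).

(** The measure is changed first, at the fixed point [x], and the point second. Note the asymmetry:
    [c] bounds the maps at all starting points, while |x - y| concerns one pair. *)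
Lemma velocity_transports f f' mu mu' (c : R) x y : 0 <= c ->
  transports f mu -> transports f' mu' ->
  (forall z, enorm (f z - f' z) <= c) ->
  enorm (v mu x - v mu' y) <= K * c + L * enorm (x - y).
Proof.
move=> c0 [mf muf] [mf' muf'] ff'.
apply: (le_trans (enormB_triangle (v mu' x) _ _)); apply: lerD; last exact: vL.
exact/vK/(Wp_le_dist p_gt0 mf mf' muf muf' c0).
Qed.

Section one_flow.
Variables (N : nat) (mu : R -> Pp n p) (X : R -> V -> V).
Hypotheses (N_gt0 : (0 < N)%N) (X_flow : lagrangian_flow T v mu0 N mu X).
Let dt := T / N%:R.

Let dt_gt0 : 0 < dt. Proof. by rewrite divr_gt0// ltr0n. Qed.
Let NdtE : N%:R * dt = T.
Proof. by rewrite /dt mulrC divfK// pnatr_eq0 -lt0n. Qed.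

Lemma lagrangian_flow_time_lipschitz s t x : 0 <= s -> s <= t -> t <= T ->
  enorm (X t x - X s x) <= M * (t - s).
Proof.
have [_ cell _ _] := X_flow; rewrite -NdtE; move: s t.
apply: (@grid_chain _ (fun s t => enorm (X t x - X s x) <= M * (t - s))).
- exact: ltW.
- by move=> s; rewrite !subrr enorm0 mulr0.
- move=> s t u _ _ st tu.
  by have := enormB_triangle (X t x) (X u x) (X s x); lra.
- move=> i s t iN si st ti; have [Y dY XY] := cell i x iN.
  rewrite !XY ?si ?ti ?(le_trans si) ?(le_trans st)//.
  rewrite mulrBr; apply: (@enorm_mean_value _ _ _ _ (fun t => M * t) (fun=> M) s t st dY).
    move=> r; have : is_derive r 1 (M \*: (@idfun R)) (M *: 1) by exact: is_deriveZ.
    by rewrite /GRing.scale /= mulr1.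
  by move=> r _; exact: vM.
Qed.

(** Between two times the factor is kept as e^(L(b - a)), which multiplies exactly when steps are
    chained. Only at the end is it relaxed to e^(LT), which depends neither on t nor on [N]. *)
Lemma lagrangian_flow_bilipschitz t x y : 0 <= t <= T ->
  enorm (X t x - X t y) <= expR (L * T) * enorm (x - y) /\
  enorm (x - y) <= expR (L * T) * enorm (X t x - X t y).
Proof.
move=> /andP[t0 tT]; have [X0 cell _ _] := X_flow.
have [h1 h2] : enorm (X t x - X t y) <= expR (L * (t - 0)) * enorm (X 0 x - X 0 y) /\
  enorm (X 0 x - X 0 y) <= expR (L * (t - 0)) * enorm (X t x - X t y).
  move: tT; rewrite -NdtE => tT.
  pose P a b := enorm (X b x - X b y) <= expR (L * (b - a)) * enorm (X a x - X a y) /\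
    enorm (X a x - X a y) <= expR (L * (b - a)) * enorm (X b x - X b y).
  apply: (@grid_chain _ P N dt (ltW dt_gt0) _ _ _ 0 t) => //.
  - by move=> s; rewrite /P subrr mulr0 expR0 mul1r.
  - move=> a b c ab bc [h1 h2] [h3 h4].
    rewrite /P; have -> : L * (c - a) = L * (c - b) + L * (b - a) by ring.
    rewrite expRD; split.
      by rewrite (le_trans h3)// -mulrA ler_wpM2l ?expR_ge0.
    by rewrite (le_trans h2)// mulrAC [leRHS]mulrC ler_wpM2l ?expR_ge0.
  - move=> i a b iN ia ab bi.
    have [Y dY XY] := cell i x iN; have [Z dZ XZ] := cell i y iN.
    rewrite /P !XY ?XZ ?ia ?bi ?(le_trans ia) ?(le_trans ab)//.
    apply: (@enorm_gronwall _ _ (fun s => Y s - Z s)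
      (fun s => v (mu (i%:R * dt)) (Y s) - v (mu (i%:R * dt)) (Z s)) L a b ab).
    by move=> s _; exact: vL.
rewrite !X0 subr0 in h1 h2.
have le : expR (L * t) <= expR (L * T) by rewrite ler_expR ler_pM2l.
by split; [apply: (le_trans h1)|apply: (le_trans h2)]; rewrite ler_wpM2r ?enorm_ge0.
Qed.

Lemma lagrangian_flow_transports t : 0 <= t <= T -> transports (X t) (mu t).
Proof.
move=> tT; have [_ _ lip muE] := X_flow; split; last exact: muE.
have [C XC] := lip t tT.
apply: continuous_measurable_mx; exact: elipschitz_continuous XC.
Qed.

Lemma lagrangian_flow_cell i : (i < N)%N -> 0 <= i%:R * dt /\ i.+1%:R * dt <= T.
Proof.
move=> iN; rewrite mulr_ge0 ?(ltW dt_gt0)//; split => //.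
by rewrite -NdtE ler_wpM2r ?ler_nat// ltW.
Qed.

(** This is the consistency error of the scheme: the price, in terms of flow maps, of freezing the
    measure at the left end of a cell. *)
Lemma lagrangian_flow_in_cell i t s : (i < N)%N ->
  i%:R * dt <= t <= i.+1%:R * dt -> i%:R * dt <= s <= i.+1%:R * dt ->
  forall x, enorm (X t x - X s x) <= M * dt.
Proof.
move=> iN ti si x.
wlog st : s t ti si / s <= t.
  by move=> wl; case: (leP s t) => [|/ltW] st; [|rewrite edistC]; exact: wl.
move: ti si => /andP[it ti] /andP[is_ si].
have [i0 iT] := lagrangian_flow_cell iN.
apply: (le_trans (lagrangian_flow_time_lipschitz _ _ _ _)) => //.
- exact: le_trans is_.
- exact: le_trans ti iT.
rewrite ler_pM2l//.
have -> : dt = i.+1%:R * dt - i%:R * dt.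
  by rewrite -mulrBl -[i.+1]addn1 natrD [_ + 1]addrC addrK mul1r.
exact: lerB.
Qed.

End one_flow.

(** * Comparison of the scheme on two nested grids *)

Section refinement.
Variables (N q : nat) (mu mu' : R -> Pp n p) (X X' : R -> V -> V).
Hypotheses (N_gt0 : (0 < N)%N) (q_gt0 : (0 < q)%N).
Hypotheses (X_flow : lagrangian_flow T v mu0 N mu X)
  (X'_flow : lagrangian_flow T v mu0 (N * q) mu' X').
Let dt := T / N%:R.
Let dt' := T / (N * q)%:R.
(** Twice the rate L + K: the integral of (L + K) S e^(lam r) up to t is then at most (S / 2) e^(lam
    t), whence the gain of a factor 1/2. *)
Let lam := 2 * (L + K).

Let Nq_gt0 : (0 < N * q)%N. Proof. by rewrite muln_gt0 N_gt0. Qed.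
Let dt_gt0 : 0 < dt. Proof. by rewrite divr_gt0// ltr0n. Qed.
Let dt'_gt0 : 0 < dt'. Proof. by rewrite divr_gt0// ltr0n. Qed.
Let dtE : dt = q%:R * dt'.
Proof.
rewrite /dt /dt' natrM; field.
by rewrite !pnatr_eq0 -!lt0n N_gt0 q_gt0.
Qed.
Let dt'_le : dt' <= dt.
Proof. by rewrite dtE ler_peMl ?(ltW dt'_gt0)// ler1n. Qed.
Let lam_gt0 : 0 < lam. Proof. by rewrite mulr_gt0// addr_gt0. Qed.

(** Inside one fine cell both velocity fields are frozen, so the difference of the two trajectories
    extends to a differentiable curve there. *)
Let subcell j t : (j < N * q)%N -> j%:R * dt' <= t <= j.+1%:R * dt' ->
  (j %/ q < N)%N /\ (j %/ q)%:R * dt <= t <= (j %/ q).+1%:R * dt.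
Proof.
move=> jN /andP[jt tj]; rewrite ltn_divLR// jN; split => //.
rewrite dtE !(mulrA _ q%:R) -!natrM; apply/andP; split.
  by rewrite (le_trans _ jt)// ler_pM2r// ler_nat leq_trunc_div.
by rewrite (le_trans tj)// ler_pM2r// ler_nat ltn_ceil.
Qed.

(* In the norm [sup_t expR (- lam t) |.|] any bound on the distance between the
   two flows improves itself by a factor [1/2], up to an error of order [dt]. *)
Let contraction (S : R) : 0 <= S ->
  (forall (t : R) x, 0 <= t <= T -> enorm (X t x - X' t x) <= S * expR (lam * t)) ->
  forall (t : R) x, 0 <= t <= T ->
    enorm (X t x - X' t x) <= (S / 2 + 2 * K * M * dt * T) * expR (lam * t).
Proof.
move=> S0 HS t x /andP[t0 tT].
(* The derivative of [psi] is (L + K) S e^(lam r) + 2 K M dt, exactly the bound found below for the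
   difference of the two velocities. *)
pose psi r := S / 2 * expR (lam * r) + 2 * K * M * dt * r.
pose D r := X r x - X' r x.
have dpsi (r : R) : is_derive r 1 psi (S / 2 * (lam * expR (lam * r)) + 2 * K * M * dt).
  have h1 : is_derive r 1 ((S / 2) \*: (fun s : R => expR (lam * s)))
      ((S / 2) *: (lam * expR (lam * r))).
    by apply: is_deriveZ; exact: is_derive_expRM.
  have h2 : is_derive r 1 ((2 * K * M * dt) \*: (@idfun R)) ((2 * K * M * dt) *: 1).
    exact: is_deriveZ.
  by have := is_deriveD h1 h2; rewrite /GRing.scale /= mulr1.
have : enorm (D t - D 0) <= psi t - psi 0.
  have [_ cell _ _] := X_flow; have [_ cell' _ _] := X'_flow.
  have NqT : (N * q)%:R * dt' = T by rewrite /dt' mulrC divfK// pnatr_eq0 -lt0n.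
  apply: (@grid_chain _ (fun a b => enorm (D b - D a) <= psi b - psi a)
    (N * q) dt' (ltW dt'_gt0) _ _ _ 0 t) => //.
  - by move=> s; rewrite !subrr enorm0.
  - by move=> a b c _ _; have := enormB_triangle (D b) (D c) (D a); lra.
  - move=> j a b jN ja ab bj.
    have sub r : a <= r <= b -> j%:R * dt' <= r <= j.+1%:R * dt'.
      by move=> /andP[ar rb]; rewrite (le_trans ja ar) (le_trans rb bj).
    have jj : a <= a <= b by rewrite lexx.
    have [iN _] := subcell jN (sub a jj).
    have [Y dY XY] := cell _ x iN; have [Y' dY' XY'] := cell' j x jN.
    have DE r : a <= r <= b -> D r = Y r - Y' r.
      move=> /sub rj; have [_ ri] := subcell jN rj.
      by rewrite /D XY// XY'.
    rewrite !DE ?lexx ?ab//.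
    apply: (@enorm_mean_value _ _ (fun r => Y r - Y' r) _ psi _ a b ab
      (fun r => is_deriveB (dY r) (dY' r)) dpsi).
    move=> r rab; have rj := sub r rab; have [_ ri] := subcell jN rj.
    have [j0 jT] := lagrangian_flow_cell Nq_gt0 jN.
    have [i0 iT] := lagrangian_flow_cell N_gt0 iN.
    have rT : 0 <= r <= T.
      by case/andP: rj => rj1 rj2; rewrite (le_trans j0)// (le_trans rj2).
    have jjc : j%:R * dt' <= j%:R * dt' <= j.+1%:R * dt'.
      by rewrite lexx ler_pM2r// ler_nat leqnSn.
    have iic : (j %/ q)%:R * dt <= (j %/ q)%:R * dt <= (j %/ q).+1%:R * dt.
      by rewrite lexx ler_pM2r// ler_nat leqnSn.
    have Yr : enorm (Y r - Y' r) <= S * expR (lam * r) by rewrite -DE// HS.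
    (* The two measures are frozen at different grid times. Moving each flow back to its own grid
       time costs at most [M * dt], since [dt' <= dt]; hence [2 * M * dt]. *)
    apply: (@le_trans _ _ (K * (S * expR (lam * r) + 2 * M * dt) + L * enorm (Y r - Y' r))).
      apply: (@velocity_transports (X ((j %/ q)%:R * dt)) (X' (j%:R * dt'))).
      - by rewrite addr_ge0 ?mulr_ge0 ?expR_ge0// ltW.
      - apply: (lagrangian_flow_transports X_flow).
        by rewrite i0 (le_trans _ iT)//; case/andP: iic.
      - apply: (lagrangian_flow_transports X'_flow).
        by rewrite j0 (le_trans _ jT)//; case/andP: jjc.
      - move=> z.
        have h1 := lagrangian_flow_in_cell N_gt0 X_flow iN iic ri z.
        have h2 := lagrangian_flow_in_cell Nq_gt0 X'_flow jN rj jjc z.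
        have h3 := HS r z rT.
        have h4 := enormB_triangle (X r z) (X ((j %/ q)%:R * dt) z) (X' (j%:R * dt') z).
        have h5 := enormB_triangle (X' r z) (X r z) (X' (j%:R * dt') z).
        have h6 : M * dt' <= M * dt by rewrite ler_pM2l.
        rewrite -/dt -/dt' in h1 h2; lra.
    have h7 : L * enorm (Y r - Y' r) <= L * (S * expR (lam * r)) by rewrite ler_pM2l.
    rewrite /lam in h7 Yr *; lra.
  by rewrite NqT.
have [X0 _ _ _] := X_flow; have [X'0 _ _ _] := X'_flow.
rewrite /D X0 X'0 subrr subr0 /psi mulr0 mulr0 addr0 expR0 => h.
apply: (le_trans h).
(* The term linear in time is put under the weight as well, so that the result has the form of the
   assumption on [S]. *)
have e1 : 1 <= expR (lam * t) by rewrite -expR0 ler_expR mulr_ge0// ltW.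
have c0 : 0 <= 2 * K * M * dt by rewrite !mulr_ge0// ltW.
have c1 : 2 * K * M * dt * t <= 2 * K * M * dt * T by rewrite ler_wpM2l.
have c2 : 2 * K * M * dt * T <= 2 * K * M * dt * T * expR (lam * t).
  by rewrite ler_peMr// mulr_ge0// ltW.
by rewrite mulr1 mulrDl; lra.
Qed.

(** The best constant in the weighted bound is [sup E]. It is finite because both flows stay within
    MT of their starting points, so S <= S / 2 + 2 K M dt T can be solved for S, which gives the
    4. *)
Lemma lagrangian_flow_refinement t x : 0 <= t <= T ->
  enorm (X t x - X' t x) <= 4 * K * M * T * expR (lam * T) * dt.
Proof.
pose E := [set r | exists s z, 0 <= s <= T /\ r = enorm (X s z - X' s z) / expR (lam * s)].
have [X0 _ _ _] := X_flow; have [X'0 _ _ _] := X'_flow.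
have E0 : E 0.
  exists 0, 0; rewrite lexx (ltW T_gt0) X0 X'0 subrr enorm0 mul0r.
  by split.
have ubE : ubound E (2 * M * T).
  move=> _ [s [z [/andP[s0 sT] ->]]].
  have h1 := lagrangian_flow_time_lipschitz N_gt0 X_flow z (lexx 0) s0 sT.
  have h2 := lagrangian_flow_time_lipschitz Nq_gt0 X'_flow z (lexx 0) s0 sT.
  rewrite X0 in h1; rewrite X'0 edistC in h2.
  have h3 := enormB_triangle z (X s z) (X' s z).
  have e1 : 1 <= expR (lam * s) by rewrite -expR0 ler_expR mulr_ge0// ltW.
  rewrite ler_pdivrMr ?expR_gt0//.
  have h4 : M * (s - 0) <= M * T by rewrite ler_pM2l// subr0.
  have h5 : 2 * M * T <= 2 * M * T * expR (lam * s).
    by rewrite ler_peMr// !mulr_ge0// ltW.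
  lra.
have supE : has_sup E by split; [exists 0|exists (2 * M * T)].
have S0 : 0 <= sup E by exact: ub_le_sup (proj2 supE) _ E0.
have HS s z : 0 <= s <= T -> enorm (X s z - X' s z) <= sup E * expR (lam * s).
  move=> sT; rewrite -ler_pdivrMr ?expR_gt0//; apply: ub_le_sup; first exact: (proj2 supE).
  by exists s, z.
have half : sup E <= sup E / 2 + 2 * K * M * dt * T.
  apply: ge_sup; first by exists 0.
  move=> _ [s [z [sT ->]]]; rewrite ler_pdivrMr ?expR_gt0//.
  exact: contraction.
move=> tT; apply: (le_trans (HS t x tT)).
have h1 : sup E <= 4 * K * M * T * dt by lra.
have -> : 4 * K * M * T * expR (lam * T) * dt = 4 * K * M * T * dt * expR (lam * T).
  by rewrite mulrAC.
have h2 : expR (lam * t) <= expR (lam * T).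
  by rewrite ler_expR ler_pM2l//; case/andP: tT.
exact: ler_pM (expR_ge0 _) h1 h2.
Qed.

End refinement.

End lagrangian_flow_estimates.

(** * The limit flow *)

Section limits.
Context {R : realType} {n : nat}.
Local Notation V := 'rV[R]_n.

Lemma ltr_geometric (c e : R) : 0 < e -> exists k, c / 2 ^+ k < e.
Proof.
move=> e0; have [c0|c0] := leP c 0.
  by exists 0%N; rewrite expr0 divr1 (le_lt_trans c0).
exists (Num.truncn (c / e)).+1; rewrite ltr_pdivrMr ?exprn_gt0//.
rewrite -ltr_pdivrMl// mulrC.
have ce0 : 0 <= c / e by rewrite divr_ge0// ltW.
rewrite (lt_le_trans (truncnS_gt _))// -natrX ler_nat.
exact/ltnW/ltn_expl.
Qed.

(** Limits in k are taken through this: an inequality for X^k becomes one for X with an explicit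
    error c / 2^k on the right. *)
Lemma ler_geometric (a b c : R) : (forall k, a <= b + c / 2 ^+ k) -> a <= b.
Proof.
move=> h; rewrite leNgt; apply/negP => ba.
have [|k ck] := @ltr_geometric c (a - b); first by rewrite subr_gt0.
have := h k; lra.
Qed.

Lemma cauchy_geometric (u : nat -> V) (C : R) :
  (forall k m, (k <= m)%N -> enorm (u k - u m) <= C / 2 ^+ k) ->
  exists l, forall k, enorm (u k - l) <= C / 2 ^+ k.
Proof.
move=> uC.
have cu : cauchy (u @ \oo).
  apply: cauchy_exP => e e0; have [k ke] := ltr_geometric C e0.
  exists (u k); exists k => // m /= km; rewrite -ball_normE /=.
  by rewrite (le_lt_trans (norm_le_enorm _))// (le_lt_trans (uC _ _ km)).
have /cvg_ex[l ul] : cvg (u @ \oo) by apply: cauchy_cvg.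
exists l => k.
apply/ler_addgt0Pr => e e0.
have e1 : 0 < e / (n%:R + 1) by rewrite divr_gt0// ltr_wpDl.
have [N _ HN] : \forall m \near \oo, `|l - u m| <= e / (n%:R + 1).
  by move/cvgrPdist_le : ul; exact.
(* The index is beyond [k] for the Cauchy bound and beyond [N] for closeness to the limit. *)
have := enormB_triangle (u (maxn k N)) (u k) l.
have := uC k (maxn k N) (leq_maxl _ _).
have := enorm_le_norm (u (maxn k N) - l).
have := HN (maxn k N) (leq_maxr _ _); rewrite /= distrC => h1 h2 h3 h4.
have h5 : n%:R * `|u (maxn k N) - l| <= e.
  have -> : e = (n%:R + 1) * (e / (n%:R + 1)).
    by rewrite mulrC divfK// gt_eqF// ltr_wpDl.
  by apply: ler_pM => //; rewrite lerDl.
lra.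
Qed.

End limits.

Section limit_flow.
Context {R : realType} {n : nat} {p : R}.
Local Notation V := 'rV[R]_n.
Variables (T : R) (v : Pp n p -> V -> V) (mu0 : Pp n p) (L M K : R).
Hypotheses (p_gt0 : 0 < p) (T_gt0 : 0 < T) (L_gt0 : 0 < L) (M_gt0 : 0 < M)
  (K_gt0 : 0 < K) (vLMK : lipschitz_velocity v L M K).
Variables (muk : nat -> R -> Pp n p) (Xk : nat -> R -> V -> V).
Hypothesis Xk_flow : forall k, lagrangian_flow T v mu0 (2 ^ k) (muk k) (Xk k).

(** The constant of [lagrangian_flow_refinement] with dt = T / 2^k, which contributes the last
    factor T. *)
Let C := 4 * K * M * T * expR (2 * (L + K) * T) * T.
Let pow_gt0 k : (0 < 2 ^ k)%N. Proof. by rewrite expn_gt0. Qed.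

(** Freezing the limit flow outside [0, T] makes its bounds hold at all real times, and later gives
    two-sided continuity in time at 0 and T. *)
Definition clamp (t : R) : R := Num.max 0 (Num.min t T).

Lemma clamp_itv t : 0 <= clamp t <= T.
Proof. by rewrite /clamp le_max lexx ge_max (ltW T_gt0) ge_min lexx orbT. Qed.

Lemma clampK t : 0 <= t <= T -> clamp t = t.
Proof. by move=> /andP[t0 tT]; rewrite /clamp min_l// max_r. Qed.

Lemma clamp_lipschitz s t : `|clamp t - clamp s| <= `|t - s|.
Proof.
wlog st : s t / s <= t.
  by move=> wl; case: (leP s t) => [|/ltW] /wl //; rewrite distrC [leRHS]distrC.
rewrite [leRHS]ger0_norm ?subr_ge0// /clamp.
rewrite ler_norml; have := T_gt0; have := st.
case: (leP s T) => ?; case: (leP t T) => ?; case: (leP 0 s) => ?;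
  case: (leP 0 t) => ?; case: (leP 0 T) => ? *; apply/andP; split; lra.
Qed.

Lemma lagrangian_flow_cauchy k m t x : (k <= m)%N -> 0 <= t <= T ->
  enorm (Xk k t x - Xk m t x) <= C / 2 ^+ k.
Proof.
move=> km tT; have qm : (0 < 2 ^ (m - k))%N := pow_gt0 _.
have Xm := Xk_flow m; rewrite -(subnKC km) expnD in Xm.
have := lagrangian_flow_refinement p_gt0 T_gt0 L_gt0 M_gt0 K_gt0 vLMK
  (pow_gt0 k) qm (Xk_flow k) Xm x tT.
by rewrite subnKC// natrX mulrA.
Qed.

Lemma limit_flow_exists : exists (X : R -> V -> V) (mub : R -> Pp n p),
  [/\ forall t k x, 0 <= t <= T -> enorm (Xk k t x - X t x) <= C / 2 ^+ k,
      forall t, X t = X (clamp t) &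
      forall t, measurable_fun setT (X t) /\
        mub t = pushforward mu0 (X t) :> (set V -> \bar R)].
Proof.
have /choice[X0 X0P] : forall tx : R * V, exists l, forall k,
    enorm (Xk k (clamp tx.1) tx.2 - l) <= C / 2 ^+ k.
  move=> [t x]; apply: cauchy_geometric => k m km.
  by apply: lagrangian_flow_cauchy => //; exact: clamp_itv.
pose X t x := X0 (clamp t, x).
have clampKK t : clamp (clamp t) = clamp t by rewrite clampK// clamp_itv.
have Xlim t k x : 0 <= t <= T -> enorm (Xk k t x - X t x) <= C / 2 ^+ k.
  by move=> tT; have := X0P (clamp t, x) k; rewrite /= clampKK {1}clampK.
have mX t : measurable_fun setT (X t).
  apply: continuous_measurable_mx.
  apply: (@elipschitz_continuous _ _ _ (expR (L * T))) => x y.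
  apply: (@ler_geometric _ _ _ (2 * C)) => k.
  have [h1 _] := lagrangian_flow_bilipschitz T_gt0 L_gt0 vLMK (pow_gt0 k)
    (Xk_flow k) x y (clamp_itv t).
  have h2 := Xlim _ k x (clamp_itv t); have h3 := Xlim _ k y (clamp_itv t).
  rewrite /X clampKK -/(X t _) in h2; rewrite /X clampKK -/(X t _) in h3.
  rewrite edistC in h2.
  have h4 := enormB_triangle (Xk k (clamp t) x) (X t x) (X t y).
  have h5 := enormB_triangle (Xk k (clamp t) y) (Xk k (clamp t) x) (X t y).
  by rewrite -mulrA; lra.
(* Comparison with the scheme for k = 0 bounds the displacement, which is what [Pp_pushforward] asks
   for. *)
have Xid t x : enorm (X t x - x) <= M * T + C.
  have h1 := Xlim _ 0%N x (clamp_itv t).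
  rewrite /X clampKK -/(X t _) expr0 divr1 edistC in h1.
  have /andP[t0 tT] := clamp_itv t.
  have h2 := lagrangian_flow_time_lipschitz T_gt0 vLMK (pow_gt0 0)
    (Xk_flow 0) x (lexx 0) t0 tT.
  have [Xk0 _ _ _] := Xk_flow 0; rewrite Xk0 subr0 in h2.
  have h3 := enormB_triangle (Xk 0 (clamp t) x) (X t x) x.
  have h4 : M * clamp t <= M * T by rewrite ler_pM2l.
  lra.
have /choice[mub mubE] : forall t, exists mu : Pp n p,
    mu = pushforward mu0 (X t) :> (set V -> \bar R).
  by move=> t; apply: (@Pp_pushforward _ _ _ p_gt0 mu0 (X t) (M * T + C)).
exists X, (mub \o clamp); split => //.
- by move=> t; apply/funext => x; rewrite /X clampKK.
- move=> t; split => //=; rewrite mubE; congr pushforward.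
  by apply/funext => x; rewrite /X clampKK.
Qed.

Variables (X : R -> V -> V) (mub : R -> Pp n p).
Hypothesis Xlim : forall t k x, 0 <= t <= T -> enorm (Xk k t x - X t x) <= C / 2 ^+ k.
Hypothesis Xclamp : forall t, X t = X (clamp t).
Hypothesis Xmub : forall t, measurable_fun setT (X t) /\
        mub t = pushforward mu0 (X t) :> (set V -> \bar R).

Lemma limit_flow_transports t : transports mu0 (X t) (mub t).
Proof. by have [mX mubE] := Xmub t; split => // A mA; rewrite mubE. Qed.

Lemma limit_flow0 x : X 0 x = x.
Proof.
apply/eqP; rewrite -subr_eq0; apply/eqP/enorm0_eq0/eqP.
rewrite eq_le enorm_ge0 andbT; apply: (@ler_geometric _ _ _ C) => k.
have [Xk0 _ _ _] := Xk_flow k.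
by rewrite add0r edistC -{1}(Xk0 x) Xlim// lexx ltW.
Qed.

Lemma limit_flow_time_lipschitz s t x : enorm (X t x - X s x) <= M * `|t - s|.
Proof.
apply: (@le_trans _ _ (M * `|clamp t - clamp s|)); last first.
  by rewrite ler_pM2l// clamp_lipschitz.
rewrite Xclamp (Xclamp s); have := clamp_itv t; have := clamp_itv s.
move: (clamp s) (clamp t) => {}s {}t.
wlog st : s t / s <= t.
  by move=> wl h1 h2; case: (leP s t) => [|/ltW] /wl; [|rewrite distrC edistC]; exact.
move=> sT tT; apply: (@ler_geometric _ _ _ (2 * C)) => k.
rewrite ger0_norm ?subr_ge0//.
have h1 := Xlim k x tT; have h2 := Xlim k x sT; rewrite edistC in h1.
have [/andP[s0 _] /andP[_ tT']] := (sT, tT).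
have h3 := lagrangian_flow_time_lipschitz T_gt0 vLMK (pow_gt0 k)
  (Xk_flow k) x s0 st tT'.
have h4 := enormB_triangle (Xk k t x) (X t x) (X s x).
have h5 := enormB_triangle (Xk k s x) (Xk k t x) (X s x).
by rewrite -mulrA; lra.
Qed.

Lemma limit_flow_bilipschitz t x y :
  enorm (X t x - X t y) <= expR (L * T) * enorm (x - y) /\
  enorm (x - y) <= expR (L * T) * enorm (X t x - X t y).
Proof.
rewrite Xclamp; have tT := clamp_itv t; split.
  apply: (@ler_geometric _ _ _ (2 * C)) => k.
  have [h1 _] := lagrangian_flow_bilipschitz T_gt0 L_gt0 vLMK (pow_gt0 k)
    (Xk_flow k) x y tT.
  have h2 := Xlim k x tT; have h3 := Xlim k y tT; rewrite edistC in h2.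
  have h4 := enormB_triangle (Xk k (clamp t) x) (X (clamp t) x) (X (clamp t) y).
  have h5 := enormB_triangle (Xk k (clamp t) y) (Xk k (clamp t) x) (X (clamp t) y).
  by rewrite -mulrA; lra.
apply: (@ler_geometric _ _ _ (expR (L * T) * (2 * C))) => k.
have [_ h1] := lagrangian_flow_bilipschitz T_gt0 L_gt0 vLMK (pow_gt0 k)
  (Xk_flow k) x y tT.
have h2 := Xlim k x tT; have h3 := Xlim k y tT; rewrite edistC in h3.
have h4 := enormB_triangle (X (clamp t) x) (Xk k (clamp t) x) (Xk k (clamp t) y).
have h5 := enormB_triangle (X (clamp t) y) (X (clamp t) x) (Xk k (clamp t) y).
apply: (le_trans h1); rewrite -mulrA -mulrDr ler_wpM2l ?expR_ge0// -mulrA; lra.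
Qed.

Lemma limit_flow_velocity s t x : 0 <= s <= T -> 0 <= t <= T ->
  enorm (X t x - X s x - (t - s) *: v (mub s) (X s x))
    <= (K + L) * M * `|t - s| ^+ 2.
Proof.
move=> sT tT; set w := v (mub s) (X s x).
(* Both orders of s and t are covered, since a two-sided derivative is to be extracted from the
   estimate. *)
pose lo := Num.min s t; pose hi := Num.max s t.
(* A bound for |velocity of X^k - w| between the two times: X^k_r is within M |t - s| + C / 2^k of
   X_s, and freezing the measure adds M dt = M T / 2^k, which is felt only through K. *)
pose E k := (K + L) * (M * `|t - s| + C / 2 ^+ k) + K * M * T / 2 ^+ k.
have lohi : lo <= hi by rewrite le_max ge_min ge_min !lexx.
have [lo0 hiT] : 0 <= lo /\ hi <= T.
  by case/andP: sT => s0 sT; case/andP: tT => t0 tT; rewrite le_min ge_max s0 t0 sT tT.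
have dist_s r : lo <= r <= hi -> `|r - s| <= `|t - s|.
  rewrite /lo /hi; case: (leP s t) => st /andP[r1 r2].
    by rewrite !ger0_norm ?subr_ge0// lerD2r.
  by rewrite !ler0_norm ?subr_le0 ?(ltW st)// lerN2 lerD2r.
have step k : enorm ((Xk k hi x - hi *: w) - (Xk k lo x - lo *: w)) <= E k * (hi - lo).
  have [_ cell _ _] := Xk_flow k.
  pose N := (2 ^ k)%N; pose dt := T / N%:R.
  have dt0 : 0 < dt by rewrite divr_gt0// ltr0n pow_gt0.
  have NdtE : N%:R * dt = T by rewrite /dt mulrC divfK// pnatr_eq0 -lt0n pow_gt0.
  have dtE : dt = T / 2 ^+ k by rewrite /dt /N natrX.
  (* [grid_chain] runs over the whole grid, so the restriction to [lo, hi] is carried inside the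
     relation. *)
  pose P a b := lo <= a -> b <= hi ->
    enorm ((Xk k b x - b *: w) - (Xk k a x - a *: w)) <= E k * (b - a).
  suff : P lo hi by apply.
  apply: (@grid_chain _ P N dt (ltW dt0)) => //; last by rewrite NdtE.
  - by move=> a _ _; rewrite !subrr enorm0 mulr0.
  - move=> a b c ab bc h1 h2 la ch.
    have := h1 la (le_trans bc ch); have := h2 (le_trans la ab) ch.
    have := enormB_triangle (Xk k b x - b *: w) (Xk k c x - c *: w) (Xk k a x - a *: w).
    lra.
  - move=> i a b iN ia ab bi la bh; have [Y dY XY] := cell i x iN.
    rewrite !XY ?ia ?bi ?(le_trans ia) ?(le_trans ab)//.
    have dw (r : R) : is_derive r 1 (fun r : R => r *: w) w.
      apply: cvg_is_derive.
      rewrite (_ : (fun h : R => _) = fun h : R => (h^-1 * h) *: w); last first.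
        by apply/funext => h; rewrite -scalerBl addrK scalerA.
      apply: cvg_near_cst; near=> h.
      by rewrite mulVf ?scale1r//; near: h; exact: nbhs_dnbhs_neq.
    have dE (r : R) : is_derive r 1 (fun r : R => E k * r) (E k).
      have : is_derive r 1 (E k \*: (@idfun R)) (E k *: 1) by exact: is_deriveZ.
      by rewrite /GRing.scale /= mulr1.
    rewrite mulrBr.
    apply: (@enorm_mean_value _ _ (fun r => Y r - r *: w) _ (fun r => E k * r) (fun=> E k) a b ab
      (fun r => is_deriveB (dY r) (dw r)) dE).
    move=> r /andP[ar rb].
    have rlohi : lo <= r <= hi by rewrite (le_trans la ar) (le_trans rb bh).
    have rT : 0 <= r <= T.
      by case/andP: rlohi => h1 h2; rewrite (le_trans lo0 h1) (le_trans h2 hiT).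
    have ri : i%:R * dt <= r <= i.+1%:R * dt by rewrite (le_trans ia ar) (le_trans rb bi).
    have ii : i%:R * dt <= i%:R * dt <= i.+1%:R * dt by rewrite lexx ler_pM2r// ler_nat leqnSn.
    have [i0 iT] := lagrangian_flow_cell T_gt0 (pow_gt0 k) iN.
    have iiT : 0 <= i%:R * dt <= T by rewrite i0 (le_trans _ iT)//; case/andP: ii.
    have close z : enorm (Xk k r z - X s z) <= C / 2 ^+ k + M * `|t - s|.
      have h1 := Xlim k z rT.
      have h2 := limit_flow_time_lipschitz s r z.
      have h3 : M * `|r - s| <= M * `|t - s| by rewrite ler_pM2l// dist_s.
      have h4 := enormB_triangle (X r z) (Xk k r z) (X s z); lra.
    rewrite -(XY r ri).
    apply: (@le_trans _ _ (K * (M * dt + (C / 2 ^+ k + M * `|t - s|)) +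
        L * enorm (Xk k r x - X s x))).
      apply: (velocity_transports p_gt0 vLMK _ _ _ (lagrangian_flow_transports (Xk_flow k) iiT)
        (limit_flow_transports s)).
        have := close 0; have := enorm_ge0 (Xk k r 0 - X s 0).
        have : 0 <= M * dt by rewrite mulr_ge0// ltW.
        lra.
      move=> z.
      have h1 := lagrangian_flow_in_cell T_gt0 M_gt0 vLMK (pow_gt0 k)
        (Xk_flow k) iN ii ri z.
      have h2 := close z.
      have h3 := enormB_triangle (Xk k r z) (Xk k (i%:R * dt) z) (X s z).
      by rewrite -/N -/dt in h1; lra.
    have h1 : L * enorm (Xk k r x - X s x) <= L * (C / 2 ^+ k + M * `|t - s|) by rewrite ler_pM2l.
    rewrite /E -[K * M * T / _]mulrA -dtE; lra.
have hilo : hi - lo = `|t - s|.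
  rewrite /hi /lo; case: (leP s t) => st; first by rewrite ger0_norm ?subr_ge0.
  by rewrite ltr0_norm ?subr_lt0// opprB.
have stepE k : enorm (Xk k t x - Xk k s x - (t - s) *: w) <= E k * `|t - s|.
  have := step k; rewrite hilo /hi /lo.
  have alg (a b : R) (A B : V) : A - a *: w - (B - b *: w) = A - B - (a - b) *: w.
    by rewrite scalerBl !opprB addrACA [RHS]addrACA; congr (_ + _); rewrite addrC.
  case: (leP s t) => st; rewrite alg//.
  by rewrite -enormN !opprB addrC -scaleNr opprB addrC [X in enorm X]addrC.
apply: (@ler_geometric _ _ _ (2 * C + ((K + L) * C + K * M * T) * `|t - s|)) => k.
have h1 := Xlim k x tT; have h2 := Xlim k x sT; rewrite edistC in h1.
have h3 := stepE k.
have h4 : enorm (X t x - X s x - (t - s) *: w) <=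
  enorm (X t x - Xk k t x) + enorm (Xk k t x - Xk k s x - (t - s) *: w) + enorm (Xk k s x - X s x).
  apply: (le_trans _ (lerD (enormD _ _) (lexx _))); apply: (le_trans _ (enormD _ _)).
  rewrite le_eqVlt; apply/orP; left; apply/eqP; congr enorm.
  by apply/rowP => i; rewrite !mxE; ring.
apply: (le_trans h4).
rewrite /E in h3; move: h1 h2 h3; set e := (2 ^+ k)^-1; rewrite expr2; lra.
Unshelve. all: by end_near. Qed.

End limit_flow.

(** * Supports and null sets of push-forwards *)

Section supports.
Context {R : realType} {n : nat} {p : R}.
Local Notation V := 'rV[R]_n.
Implicit Types mu : Pp n p.

Lemma msupport_closed mu : closed (msupport mu).
Proof.
move=> x clx U oU Ux; have [|y [ysupp Uy]] := clx U; first exact: open_nbhs_nbhs.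
exact: ysupp.
Qed.

Lemma negligible_bigsetU mu (I : choiceType) (s : seq I) (F : I -> set V) :
  (forall i, i \in s -> mu.-negligible (F i)) ->
  mu.-negligible (\big[setU/set0]_(i <- s) F i).
Proof.
elim: s => [|i s IH] H; first by rewrite big_nil; exact: negligible_set0.
rewrite big_cons; apply: negligibleU; first by apply: H; rewrite mem_head.
by apply: IH => j js; apply: H; rewrite in_cons js orbT.
Qed.

(** Each point off the support has a null open neighbourhood, and finitely many of these cover a
    compact set. *)
Lemma compact_negligible mu (A : set V) : compact A ->
  A `&` msupport mu = set0 -> mu.-negligible A.
Proof.
move=> cA Asupp.
have /choice[U UP] : forall x : V, exists U, A x ->
    [/\ open U, U x & mu.-negligible U].
  move=> x; have [Ax|nAx] := pselect (A x); last by exists set0.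
  have : ~ msupport mu x by move=> sx; have : set0 x by rewrite -Asupp.
  move=> /existsNP[U /not_implyP[oU /not_implyP[Ux /negP U0]]]; exists U => _; split => //.
  apply/negligibleP; first exact: open_measurable_mx.
  by apply/eqP; rewrite eq_le measure_ge0 andbT leNgt.
have := cA; rewrite compact_cover => /(_ _ A U)[||D' D'A AD'].
- by move=> x /UP[].
- by move=> x Ax; exists x => //; have [] := UP x Ax.
apply: negligibleS AD' _; rewrite /cover bigcup_fset.
by apply: negligible_bigsetU => x /D'A; rewrite inE => /UP[].
Qed.

(** A null complement of a ball, unlike the support itself, is easy to push forward. It is exhausted
    by compact shells; starting them at r + 2 keeps them off the support, which lies in the ball of
    radius r + 1. *)
Lemma compact_support_negligible mu : compact (msupport mu) ->
  exists r : R, mu.-negligible [set x | r < `|x|].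
Proof.
move=> /compact_bounded[r [_ rP]].
have rsupp x : msupport mu x -> `|x| <= r + 1 by apply: rP; rewrite ltrDl.
exists (r + 2).
pose A m : set V := Num.norm @^-1` `[r + 2, m%:R].
have rA : [set x : V | r + 2 < `|x|] `<=` \bigcup_m A m.
  move=> x /= rx; exists (Num.truncn `|x|).+1 => //=.
  by rewrite /A /= in_itv/= (ltW rx) ltW// truncnS_gt.
apply: negligibleS rA _; apply: negligible_bigcup => m; apply: compact_negligible.
  apply: bounded_closed_compact; last first.
    apply: closed_comp; last exact: itv_closed.
    by move=> x _; exact: norm_continuous.
  exists m%:R; split; first by rewrite num_real.
  by move=> y my x; rewrite /A /= in_itv/= => /andP[_ /le_trans]; apply; exact: ltW.
rewrite -subset0 => x []; rewrite /A /= in_itv/= => /andP[rx _] /rsupp xr.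
by have := le_trans rx xr; rewrite lerD2l; lra.
Qed.

Lemma open_norm_gt (r : R) : open [set x : V | r < `|x|].
Proof.
rewrite (_ : [set x : V | _] = Num.norm @^-1` `]r, +oo[%classic).
  by apply: open_comp; [move=> z _; exact: norm_continuous|exact: interval_open].
by apply/seteqP; split=> z /=; rewrite in_itv/= andbT.
Qed.

Lemma negligible_bounded_support mu (r : R) : mu.-negligible [set x | r < `|x|] ->
  compact (msupport mu).
Proof.
move=> mur; apply: bounded_closed_compact; last exact: msupport_closed.
exists r; split; first by rewrite num_real.
move=> y ry x xsupp; rewrite /= leNgt; apply/negP => yx.
have := xsupp _ (@open_norm_gt y) yx.
suff -> : mu [set x : V | y < `|x|] = 0%E by rewrite ltxx.
apply/negligibleP; first by apply: open_measurable_mx; exact: (@open_norm_gt y).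
by apply: negligibleS mur => z /=; exact: lt_trans.
Qed.

Lemma compact_support_pushforward mu (nu : Pp n p) (f : V -> V) (C : R) :
  measurable_fun setT f -> (forall x, enorm (f x - x) <= C) ->
  nu = pushforward mu f :> (set V -> \bar R) ->
  compact (msupport mu) -> compact (msupport nu).
Proof.
move=> mf fC nuE /compact_support_negligible[r /negligibleP].
move=> /(_ (open_measurable_mx (@open_norm_gt r))) r0.
apply: (@negligible_bounded_support _ (r + C)).
have mS s : measurable [set x : V | s < `|x|].
  by apply: open_measurable_mx; exact: (@open_norm_gt s).
apply/negligibleP => //.
suff h : mu (f @^-1` [set x | r + C < `|x|]) = 0%E.
  exact: etrans (congr1 (fun m => m [set x | r + C < `|x|]) nuE) h.
apply/eqP; rewrite eq_le measure_ge0 andbT -[leRHS]r0; apply: le_measure; rewrite ?inE//.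
  by rewrite -[X in measurable X]setTI; exact: mf.
move=> x /= rx; have := norm_le_enorm (f x - x); have := fC x.
have := ler_normD (f x - x) x; rewrite subrK; lra.
Qed.

End supports.

(** * Null sets under maps with a Lipschitz inverse *)

Section lebesgue_null_sets.
Context {R : realType} {n : nat}.
Local Notation V := 'rV[R]_n.
Implicit Types (A B : set V).

Let vol (a b : V) : R := \prod_(i < n) (b 0 i - a 0 i).

Let vol_ge0 (a b : V) : (forall i, a 0 i <= b 0 i) -> 0 <= vol a b.
Proof. by move=> ab; apply: prodr_ge0 => i _; rewrite subr_ge0. Qed.

(** A cover witnessing that the outer measure is at most [c]; unlike the infimum, such witnesses can
    be merged over countable unions. *)
Let box_cover A (c : \bar R) := exists a b : nat -> V,
  [/\ forall k i, a k 0 i <= b k 0 i, A `<=` \bigcup_k box (a k) (b k) &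
      (\sum_(0 <= k <oo) (vol (a k) (b k))%:E <= c)%E].

Let box_cover_le A c : box_cover A c -> (lebesgue_outer A <= c)%E.
Proof.
move=> [a [b [ab Aab le_c]]]; apply: ge_ereal_inf.
by exists (\sum_(0 <= k <oo) (vol (a k) (b k))%:E)%E => //; exists a, b.
Qed.

Let box_cover_bigcup (F : nat -> set V) (c : nat -> R) :
  (forall k, box_cover (F k) (c k)%:E) ->
  box_cover (\bigcup_k F k) (\sum_(0 <= k <oo) (c k)%:E)%E.
Proof.
move=> /choice[a /choice[b abP]].
have ab k r i : a k r 0 i <= b k r 0 i by have [] := abP k.
have /card_esym/ppcard_eqP[f] := card_nat2.
exists (fun j => a (f j).1 (f j).2), (fun j => b (f j).1 (f j).2); split => //.
  move=> x [k _ Fx]; have [_ /(_ _ Fx)[r _ xr] _] := abP k.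
  by exists (f^-1%FUN (k, r)) => //=; rewrite invK ?inE.
pose w z : \bar R := (vol (a z.1 z.2) (b z.1 z.2))%:E.
have w0 z : (0 <= w z)%E by rewrite lee_fin vol_ge0.
rewrite (nneseries_esumT (a := fun j => w (f j)))//.
rewrite -(@reindex_esum _ _ _ setT setT f w); last exact: bij.
rewrite (_ : setT = setT `*`` (fun=> setT)); last by apply/seteqP; split.
rewrite -(@esum_esum _ _ _ setT (fun=> setT) (fun k r => w (k, r)))//.
rewrite -nneseries_esumT; last by move=> k; exact: esum_ge0.
apply: lee_nneseries => [k _ _|k _]; first exact: esum_ge0.
by rewrite -nneseries_esumT//; have [] := abP k.
Qed.

(** The finite list is continued by the degenerate box at 0. Its volume is 0 only because n > 0, the
    empty product being 1. *)
Let box_cover_seq A (I : eqType) (s : seq I) (a b : I -> V) (c : R) : (0 < n)%N ->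
  (forall i j, a i 0 j <= b i 0 j) ->
  (forall x, A x -> exists2 i, i \in s & box (a i) (b i) x) ->
  \sum_(i <- s) vol (a i) (b i) <= c -> box_cover A c%:E.
Proof.
move=> n0 ab As sc; case: s As sc => [|i0 s0].
  move=> A0; rewrite big_nil => c0; exists (fun=> 0), (fun=> 0); split => //.
    by move=> x /A0[].
  rewrite eseries0 ?lee_fin// => k _ _; congr EFin.
  by rewrite /vol (bigD1 (Ordinal n0))//= subrr mul0r.
set s := i0 :: s0 => As sc.
pose g (u : I -> V) r : V := if (r < size s)%N then u (nth i0 s r) else 0.
exists (g a), (g b); split.
- by move=> k i; rewrite /g; case: ifP.
- move=> x /As[i si xi]; exists (index i s) => //.
  by rewrite /g index_mem si nth_index.
- rewrite (nneseries_split 0 (size s)); last first.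
    by move=> k _; rewrite lee_fin vol_ge0// /g; case: ifP.
  rewrite [X in (_ + X)%E]eseries0 ?adde0; last first.
    move=> k; rewrite add0n leqNgt => /negbTE sk _; rewrite /g sk; congr EFin.
    by rewrite /vol (bigD1 (Ordinal n0))//= subrr mul0r.
  rewrite add0n sumEFin lee_fin (le_trans _ sc)//.
  rewrite (big_nth i0) le_eqVlt; apply/orP; left; apply/eqP.
  by apply: eq_big_nat => k /= ks; rewrite /g ks.
Qed.

Variables (f : V -> V) (C : R).
Hypotheses (n_gt0 : (0 < n)%N) (C_gt0 : 0 < C).
Hypothesis f_inv : forall x y, enorm (x - y) <= C * enorm (f x - f y).

(** The volume of a cube of side 2 C n s, relative to that of a cube of side s. *)
Let D := (2 * C * n%:R) ^+ n.

(* A long box is first cut into cubes, whose preimages have small diameter. *)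
Let box_cover_preimage_box (a b : V) (d : R) : 0 < d -> (forall i, a 0 i <= b 0 i) ->
  box_cover (f @^-1` box a b) (D * (vol a b + d))%:E.
Proof.
move=> d0 ab.
(* The side [s] of the cubes is so small that lengthening every edge of the box by [s], to allow for
   rounding up, adds at most [d] to the volume. *)
have [s s0 sd] : exists2 s, 0 < s & \prod_(i < n) (b 0 i - a 0 i + s) <= vol a b + d.
  have : continuous (fun s : R => \prod_(i < n) (b 0 i - a 0 i + s)).
    apply: (continuous_big (@mul_continuous R)) => i _ x.
    by apply: cvgD; [exact: cvg_cst|exact: cvg_id].
  move=> /(_ 0)/cvgrPdist_le/(_ d d0)/nbhs_ballP[e /= e0 /(_ (e / 2))].
  rewrite /ball /= sub0r normrN ger0_norm ?divr_ge0 ?(ltW e0)//.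
  rewrite ltr_pdivrMr// ltr_pMr// ltr1n => /(_ isT) h.
  exists (e / 2); first by rewrite divr_gt0.
  move: h; rewrite ler_norml => /andP[+ _].
  under eq_bigr do rewrite addr0.
  by rewrite -/(vol a b); lra.
pose Nc i := (Num.truncn ((b 0 i - a 0 i) / s)).+1.
pose N := (\max_i Nc i).+1.
have NcN i : (Nc i < N)%N by rewrite ltnS; exact: (@leq_bigmax _ Nc).
pose Q (i : 'I_n) : pred 'I_N := fun j => (j < Nc i)%N.
pose cube (h : {ffun 'I_n -> 'I_N}) : set V :=
  box (\row_i (a 0 i + (h i)%:R * s)) (\row_i (a 0 i + (h i).+1%:R * s)).
(* [z h] is a point mapped into the cube [h], with default 0 if there is none. Any other such point
   has its image within s of that of [z h] in max norm, so it lies within C n s of [z h]. *)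
have /choice[z zP] : forall h, exists z, (exists x, cube h (f x)) -> cube h (f z).
  by move=> h; have [[x xh]|no] := pselect (exists x, cube h (f x)); [exists x|exists 0].
have e0 : 0 <= C * n%:R * s by rewrite !mulr_ge0// ltW.
apply: (@box_cover_seq _ _ (enum (family Q)) (fun h => z h - const_mx (C * n%:R * s))
  (fun h => z h + const_mx (C * n%:R * s))) => //.
- by move=> h j; rewrite !mxE lerD2l ge0_cp.
- move=> x /= fx.
  have idx i : exists j : 'I_N, Q i j /\
      a 0 i + j%:R * s <= (f x) 0 i <= a 0 i + j.+1%:R * s.
    have /andP[ax xb] := fx i.
    pose j := Num.truncn (((f x) 0 i - a 0 i) / s).
    have y0 : 0 <= ((f x) 0 i - a 0 i) / s by rewrite divr_ge0 ?subr_ge0// ltW.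
    have jN : (j < Nc i)%N.
      by rewrite ltnS le_truncn// ler_pM2r ?invr_gt0// lerD2r.
    exists (Ordinal (ltn_trans jN (NcN i))); split => //=; apply/andP; split.
      by rewrite -lerBrDl -ler_pdivlMr// /j truncn_le.
    by rewrite -lerBlDl -ler_pdivrMr// ltW// truncnS_gt.
  have /choice[h hP] := idx.
  exists [ffun i => h i].
    rewrite mem_enum; apply/familyP => i; rewrite ffunE.
    by have [] := hP i.
  set h' := finfun _.
  have xh : cube h' (f x) by move=> i; rewrite !mxE ffunE; have [] := hP i.
  have zh : cube h' (f (z h')) by apply: zP; exists x.
  move=> i; rewrite !mxE.
  have : `|(x - z h') 0 i| <= C * n%:R * s.
    apply: (le_trans (coord_le_enorm _ _)); apply: (le_trans (f_inv _ _)).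
    rewrite -mulrA ler_pM2l//; apply: (le_trans (enorm_le_norm _)).
    rewrite ler_wpM2l// [leLHS]/Num.Def.normr/= mx_normrE.
    apply: (bigmax_le _ (ltW s0)) => /= -[i' j] _; rewrite ord1 !mxE /=.
    have := xh j; have := zh j; rewrite !mxE.
    rewrite -[(h' j).+1]addn1 natrD => /andP[h1 h2] /andP[h3 h4].
    by rewrite ler_norml; apply/andP; split; lra.
  by rewrite !mxE ler_norml => /andP[h1 h2]; apply/andP; split; lra.
have volE h : vol (z h - const_mx (C * n%:R * s)) (z h + const_mx (C * n%:R * s)) =
    D * \prod_(i < n) s.
  rewrite /vol (eq_bigr (fun=> 2 * C * n%:R * s)); last by move=> i _; rewrite !mxE; ring.
  by rewrite !prodr_const card_ord exprMn.
under eq_bigr do rewrite volE.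
rewrite -mulr_sumr ler_wpM2l ?exprn_ge0 ?mulr_ge0 ?(ltW C_gt0)//.
(* The sum over cubes factors into the product over i of [Nc i * s], and [Nc i * s] is at most the
   i-th edge plus s. *)
rewrite big_enum /= -(bigA_distr_big_dep _ (fun _ _ => s)).
apply: le_trans sd; apply: ler_prod => i _.
rewrite sumr_const.
have -> : #|Q i| = Nc i.
  rewrite -sum1_card (eq_bigl (fun j : 'I_N => (j < Nc i)%N))//.
  by rewrite -(big_ord_widen _ (fun=> 1%N) (ltnW (NcN i))) sum1_card card_ord.
apply/andP; split; first by rewrite mulrn_wge0// ltW.
rewrite -mulr_natl -natr1 mulrDl mul1r lerD2r -ler_pdivlMr//.
by rewrite truncn_le divr_ge0 ?subr_ge0// ltW.
Qed.

Lemma lebesgue_outer_preimage_pos B : lebesgue_outer B = 0%E ->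
  lebesgue_outer (f @^-1` B) = 0%E.
Proof.
move=> B0; apply/eqP; rewrite eq_le; apply/andP; split; last first.
  apply: le_ereal_inf_tmp => _ [a [b [ab _ ->]]].
  by apply: nneseries_ge0 => k _ _; rewrite lee_fin vol_ge0.
have D0 : 0 < D by rewrite exprn_gt0// !mulr_gt0// ltr0n.
apply/lee_addgt0Pr => e e0; rewrite add0e.
(* One [e'] pays for the cover of [B], another for the errors e' / 2^(k+1) of all its boxes;
   multiplied by [D], they add up to [e]. *)
pose e' := e / (2 * D).
have e'0 : 0 < e' by rewrite divr_gt0// mulr_gt0.
have [_ [a [b [ab Bab ->]]] abe] : exists2 s, [set s | exists a b : nat -> V,
    [/\ forall k i, a k 0 i <= b k 0 i, B `<=` \bigcup_k box (a k) (b k) &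
        s = (\sum_(0 <= k <oo) (vol (a k) (b k))%:E)%E]] s & (s < e'%:E)%E.
  by apply: ereal_inf_lt; rewrite -/(lebesgue_outer B) B0 lte_fin.
pose c k := D * (vol (a k) (b k) + e' / (2 ^ k.+1)%:R).
have cov : box_cover (\bigcup_k (f @^-1` box (a k) (b k))) (\sum_(0 <= k <oo) (c k)%:E)%E.
  apply: box_cover_bigcup => k; apply: box_cover_preimage_box => //.
  by rewrite divr_gt0// ltr0n expn_gt0.
have : (lebesgue_outer (f @^-1` B) <= \sum_(0 <= k <oo) (c k)%:E)%E.
  apply: box_cover_le; case: cov => u [w [uw cuw le_c]]; exists u, w; split => //.
  by apply: subset_trans cuw; rewrite -preimage_bigcup; exact: preimage_subset.
move=> /le_trans; apply; rewrite /c; under eq_eseriesr do rewrite EFinM EFinD.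
rewrite nneseriesZl; last first.
  by move=> k _; rewrite -EFinD lee_fin addr_ge0 ?vol_ge0// divr_ge0// ltW.
apply: (@le_trans _ _ (D%:E * (e'%:E + e'%:E))%E).
  apply: lee_wpmul2l; first by rewrite lee_fin ltW.
  apply: (le_trans (epsilon_trick _ _ _)); last exact/leeD/lexx/ltW.
  - by move=> k; rewrite lee_fin vol_ge0.
  - exact: ltW.
rewrite -EFinD -EFinM lee_fin /e' le_eqVlt; apply/orP; left; apply/eqP.
by field; rewrite gt_eqF.
Qed.

End lebesgue_null_sets.

Section absolute_continuity_pushforward.
Context {R : realType} {n : nat}.
Local Notation V := 'rV[R]_n.

Lemma lebesgue_outer_ge0 (A : set V) : (0 <= lebesgue_outer A)%E.
Proof.
apply: le_ereal_inf_tmp => _ [a [b [ab _ ->]]].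
apply: nneseries_ge0 => k _ _; rewrite lee_fin.
by apply: prodr_ge0 => i _; rewrite subr_ge0.
Qed.

Lemma lebesgue_outerS (A B : set V) :
  A `<=` B -> (lebesgue_outer A <= lebesgue_outer B)%E.
Proof.
move=> AB; apply: ereal_inf_le_tmp => _ [a [b [ab Bab ->]]].
by exists a, b; split => //; exact: subset_trans Bab.
Qed.

Lemma lebesgue_outer_preimage (f : V -> V) (C : R) (B : set V) : 0 < C ->
  (forall x y, enorm (x - y) <= C * enorm (f x - f y)) ->
  lebesgue_outer B = 0%E -> lebesgue_outer (f @^-1` B) = 0%E.
Proof.
(* For n = 0 the space is a single point and [f] is the identity. *)
move=> C0 fC B0; have [n0|n0] := ltnP 0 n; first exact: (lebesgue_outer_preimage_pos n0 C0 fC B0).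
rewrite (_ : f @^-1` B = B)//; apply/funext => x /=; congr B.
by apply/rowP => -[i ii]; exfalso; have := leq_trans ii n0.
Qed.

Lemma pushforward_null_dominates (mu nu : set V -> \bar R) (f : V -> V) (C : R) :
  0 < C -> (forall x y, enorm (x - y) <= C * enorm (f x - f y)) ->
  measurable_fun setT f -> nu = pushforward mu f ->
  mu `<< lebesgue_outer -> nu `<< lebesgue_outer.
Proof.
move=> C0 fC mf -> mu_ac A A0 B mB BA; rewrite /pushforward.
have mfB : measurable (f @^-1` B) by rewrite -[X in measurable X]setTI; exact: mf.
(* Domination is tested on sets all of whose measurable subsets are null; monotonicity of the outer
   measure provides this for the preimage. *)
apply: (mu_ac (f @^-1` B)) => // D mD DfB.
apply/eqP; rewrite eq_le lebesgue_outer_ge0 andbT.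
by rewrite -(lebesgue_outer_preimage C0 fC (A0 B mB BA)) lebesgue_outerS.
Qed.

End absolute_continuity_pushforward.

(** * Continuity and convergence of curves of measures *)

Section curve_convergence.
Context {R : realType} {n : nat} {p : R}.

Lemma Ccurve_lipschitz (T C : R) (mu : R -> Pp n p) :
  (forall s t, 0 <= s <= T -> 0 <= t <= T ->
    (Wp (mu s) (mu t) <= (C * `|s - t|)%:E)%E) -> Ccurve T mu.
Proof.
move=> muC t; rewrite in_itv /= => tT.
apply: (@squeeze_cvge _ _ _ _ (cst 0%E) _ (fun s => (C * `|s - t|)%:E)).
- near=> s; rewrite Wp_ge0 /=; apply: muC => //.
  by have : [set` `[0, T]] s by near: s; exact: withinT.
- exact: cvg_cst.
- apply: cvg_within_filter; apply: cvg_EFin; first exact: nearW.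
  rewrite [X in _ --> X](_ : _ = C * `|t - t|); last by rewrite subrr normr0 mulr0.
  apply: cvgM; first exact: cvg_cst.
  by apply: cvg_norm; apply: cvgB; [exact: cvg_id|exact: cvg_cst].
Unshelve. all: by end_near. Qed.

Lemma dcurve_geometric (T C : R) (muk : nat -> R -> Pp n p) (mu : R -> Pp n p) :
  0 <= T -> (forall k t, 0 <= t <= T -> (Wp (muk k t) (mu t) <= (C / 2 ^+ k)%:E)%E) ->
  dcurve T (muk k) mu @[k --> \oo] --> 0%E.
Proof.
move=> T0 muC.
apply: (@squeeze_cvge _ _ _ _ (cst 0%E) _ (fun k => (C / 2 ^+ k)%:E)).
- apply: nearW => k; apply/andP; split.
    apply: (le_trans (Wp_ge0 (muk k 0) (mu 0))); apply: ereal_sup_ubound.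
    by exists 0 => //=; rewrite in_itv /= lexx.
  apply: ge_ereal_sup => _ [t /= tT <-]; apply: muC.
  by move: tT; rewrite in_itv.
- exact: cvg_cst.
- apply: cvg_EFin; first exact: nearW.
  under eq_fun do rewrite /= -exprVn.
  apply: (@cvg_geometric _ C 2^-1); rewrite ger0_norm ?invr_ge0//.
  by rewrite invf_lt1// ltr1n.
Qed.

End curve_convergence.

(** * The weak formulation *)

Section test_functions.
Context {R : realType} {n : nat}.
Local Notation V := 'rV[R]_n.
Variables (T : R) (f : R * V -> R).
Hypothesis f_test : test_function T f.

Lemma test_function_differentiable z : differentiable f z.
Proof. by have [/(_ 1%N)[]] := f_test. Qed.

Lemma test_function_diff_continuous h : continuous (fun z => 'd f z h).
Proof. by have [/(_ 1%N)[_ /(_ h)]] := f_test. Qed.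

Lemma test_function_eq0 t x : ~~ (0 < t < T) -> f (t, x) = 0.
Proof.
move=> tT; have [_ _ sub] := f_test; apply/eqP; apply: contraNT tT => fx.
by apply: (sub (t, x)); exact: subset_closure.
Qed.

(** The differential is continuous on the compact support, and off it [f] vanishes near the
    point. *)
Lemma test_function_diff_bounded h : exists B, forall z, `|'d f z h| <= B.
Proof.
have [_ cS _] := f_test; set S := closure _ in cS.
have cd : {within S, continuous (fun z => 'd f z h)}.
  exact/continuous_subspaceT/test_function_diff_continuous.
have /compact_bounded[r [_ rP]] := continuous_compact cd cS.
exists (`|r| + 1) => z; have [Sz|nSz] := pselect (S z).
  apply: (rP (`|r| + 1)); last by exists z.
  by rewrite (le_lt_trans (ler_norm _))// ltrDl.
suff -> : 'd f z h = 0 by rewrite normr0 addr_ge0.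
rewrite -deriveE; last exact: test_function_differentiable.
rewrite (@near_eq_derive _ _ _ f (cst 0)) ?derive_cst//.
have oS : open (~` S) by apply: closed_openC; exact: closed_closure.
apply: filterS (open_nbhs_nbhs (conj oS nSz)) => y nSy /=.
apply: contrapT => /eqP fy; apply: nSy; exact: (@subset_closure _ [set z | f z != 0]).
Qed.

(** Continuity and boundedness of the differential are available for a fixed direction, whereas (1,
    w) will vary with the point; linearity reduces to finitely many fixed directions. *)
Lemma test_function_diffE z (w : V) :
  'd f z (1, w) = 'd f z (1, 0) + \sum_(i < n) w 0 i * 'd f z (0, delta_mx 0 i).
Proof.
have -> : (1, w) = (1, 0) + \sum_(i < n) w 0 i *: ((0, delta_mx 0 i) : R * V).
  apply/eqP; rewrite xpair_eqE; apply/andP; split; apply/eqP => /=.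
    by rewrite (raddf_sum fst)/= big1 ?addr0// => i _; rewrite scaler0.
  by rewrite (raddf_sum snd)/= add0r {1}[w]row_sum_delta.
rewrite linearD linear_sum; congr (_ + _).
by apply: eq_bigr => i _; rewrite linearZ.
Qed.

Lemma test_function_partial (t : R) (x : V) (g : R -> R * V) (v : R * V) :
  (forall h, g h = h *: v + (t, x)) ->
  (fun h : R => h^-1 *: (f (g h) - f (t, x))) @ 0^' --> 'd f (t, x) v.
Proof.
move=> gE; have df := test_function_differentiable (t, x).
rewrite (_ : (fun h : R => _) = fun h => h^-1 *: ((f \o shift (t, x)) (h *: v) - f (t, x))).
  by rewrite -deriveE//; exact: diff_derivable.
by apply/funext => h /=; rewrite gE.
Qed.

(** With [w] the velocity of a trajectory, the right-hand side is the chain rule for f (t, X t x),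
    which links the weak formulation to the flow. *)
Lemma test_function_integrandE t x (w : V) :
  dtime f t x + dotp (grad f t x) w = 'd f (t, x) (1, w).
Proof.
rewrite test_function_diffE /dtime derive1E; congr (_ + _).
  apply: cvg_lim => //; apply: (@test_function_partial _ _ (fun h => (h *: 1 + t, x))) => h.
  by rewrite [RHS](_ : _ = (h *: 1 + t, h *: 0 + x))// scaler0 add0r.
apply: eq_bigr => i _; rewrite mxE mulrC; congr (_ * _).
apply: cvg_lim => //; apply: (@test_function_partial _ _ (fun h => (t, h *: delta_mx 0 i + x))) => h.
by rewrite [RHS](_ : _ = (h *: 0 + t, h *: delta_mx 0 i + x))// scaler0 add0r.
Qed.

End test_functions.

Section weak_formulation.
Context {R : realType} {n : nat} {p : R}.
Local Notation V := 'rV[R]_n.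
Variables (T : R) (v : Pp n p -> V -> V) (mu0 : Pp n p) (L M K : R).
Hypotheses (p_gt0 : 0 < p) (T_gt0 : 0 < T) (L_gt0 : 0 < L) (M_gt0 : 0 < M)
  (K_gt0 : 0 < K) (vLMK : lipschitz_velocity v L M K).
Variables (X : R -> V -> V) (mub : R -> Pp n p) (E : R).
Hypothesis Xmub : forall t, measurable_fun setT (X t) /\
  mub t = pushforward mu0 (X t) :> (set V -> \bar R).
Hypothesis X_time : forall s t x, enorm (X t x - X s x) <= M * `|t - s|.
Hypothesis X_lip : forall t x y, enorm (X t x - X t y) <= E * enorm (x - y).
Hypothesis X_vel : forall s t x, 0 <= s <= T -> 0 <= t <= T ->
  enorm (X t x - X s x - (t - s) *: v (mub s) (X s x)) <= (K + L) * M * `|t - s| ^+ 2.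
Variable f : R * V -> R.
Hypothesis f_test : test_function T f.

Let vL := let: And3 h _ _ := vLMK in h.
Let vM := let: And3 _ h _ := vLMK in h.
Let W t x := v (mub t) (X t x).
Let g t x := 'd f (t, X t x) (1, W t x).
Let u t x := f (t, X t x).

Let lipschitz_time_continuous (c : R -> V) (C : R) :
  (forall s t, enorm (c t - c s) <= C * `|t - s|) -> continuous c.
Proof.
move=> cC; apply: continuous_epsdelta => t e e0.
exists (e / (`|C| + 1)) => [|s ts]; first by rewrite divr_gt0// ltr_wpDl.
apply: (le_trans (norm_le_enorm _)); apply: (le_trans (cC _ _)).
rewrite ler_pdivlMr ?ltr_wpDl// in ts; apply: le_trans ts; rewrite mulrC.
by rewrite ler_wpM2l// (le_trans (ler_norm _))// lerDl.
Qed.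

Let X_cont t : continuous (X t).
Proof. exact: elipschitz_continuous (X_lip t). Qed.

Let W_cont t : continuous (W t).
Proof.
move=> x; apply: (@continuous_comp _ _ _ (X t) (v (mub t))); first exact: X_cont.
exact: elipschitz_continuous (vL (mub t)) _.
Qed.

Let X_cont_time x : continuous (X^~ x).
Proof. by apply: (@lipschitz_time_continuous _ M) => s t; exact: X_time. Qed.

Let W_cont_time x : continuous (W^~ x).
Proof.
apply: (@lipschitz_time_continuous _ (K * M + L * M)) => s t.
have tr r : transports mu0 (X r) (mub r).
  by have [mX mubE] := Xmub r; split => // A mA; rewrite mubE.
apply: (le_trans (velocity_transports p_gt0 vLMK (X t x) (X s x) _ (tr t) (tr s) (X_time s t))).
  by rewrite mulr_ge0// ltW.
by rewrite mulrDl -!mulrA lerD2l ler_pM2l.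
Qed.

Let gE t x : g t x = 'd f (t, X t x) (1, 0) +
  \sum_(i < n) W t x 0 i * 'd f (t, X t x) (0, delta_mx 0 i).
Proof. by rewrite /g (test_function_diffE f). Qed.

Let comp_continuous (Y : topologicalType) (G : R * V -> R) (a : Y -> R) (b : Y -> V) :
  continuous G -> continuous a -> continuous b -> continuous (fun y => G (a y, b y)).
Proof.
move=> cG ca cb y; apply: (@continuous_comp _ _ _ (fun y => (a y, b y)) G); last exact: cG.
exact: (cvg_pair (ca y) (cb y)).
Qed.

Let df_cont h : continuous (fun z => 'd f z h).
Proof. move=> z; exact: (test_function_diff_continuous f_test). Qed.

Let g_comp_continuous (Y : topologicalType) (a : Y -> R) (b w : Y -> V) :
  continuous a -> continuous b -> continuous w ->
  continuous (fun y => 'd f (a y, b y) (1, 0) +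
    \sum_(i < n) w y 0 i * 'd f (a y, b y) (0, delta_mx 0 i)).
Proof.
move=> ca cb cw y; have h1 := comp_continuous (@df_cont (1, 0)) ca cb.
apply: cvgD; first exact: h1.
apply: (continuous_big (@add_continuous R)) => i _ {}y.
apply: cvgM; last exact: (comp_continuous (@df_cont (0, delta_mx 0 i)) ca cb).
apply: (@continuous_comp _ _ _ w (fun z : V => z 0 i)); first exact: cw.
exact: coord_continuous_row.
Qed.

Let g_cont t : continuous (g t).
Proof.
rewrite (funext (gE t)).
apply: (@g_comp_continuous _ (fun=> t) (X t) (W t)).
- exact: cst_continuous.
- exact: X_cont.
- exact: W_cont.
Qed.

Let g_cont_time x : continuous (g^~ x).
Proof.
rewrite (funext (gE^~ x)).
apply: (@g_comp_continuous _ id (X^~ x) (W^~ x)).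
- by move=> t; exact: cvg_id.
- exact: X_cont_time.
- exact: W_cont_time.
Qed.

Let f_cont : continuous f.
Proof.
move=> z; apply: differentiable_continuous; exact: (test_function_differentiable f_test).
Qed.

Let u_cont t : continuous (u t).
Proof. by apply: (@comp_continuous _ f (fun=> t) (X t)) => //; exact: cst_continuous. Qed.

Let u_cont_time x : continuous (u^~ x).
Proof. by apply: (@comp_continuous _ f id (X^~ x)) => //; move=> t; exact: cvg_id. Qed.

Let g_bound : exists2 B, 0 <= B & forall t x, `|g t x| <= B.
Proof.
have [B0 B0P] := test_function_diff_bounded f_test (1, 0).
have /choice[B BP] := fun i => test_function_diff_bounded f_test (0, delta_mx 0 i).
have gB t x : `|g t x| <= B0 + \sum_(i < n) M * B i.
  rewrite gE (le_trans (ler_normD _ _))// lerD//.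
  rewrite (le_trans (ler_norm_sum _ _ _))//; apply: ler_sum => i _.
  rewrite normrM ler_pM// (le_trans (coord_le_enorm _ _))//; exact: vM.
by exists (B0 + \sum_(i < n) M * B i) => //; exact: le_trans (normr_ge0 _) (gB 0 0).
Qed.

Let u_bound : exists B, forall t x, `|u t x| <= B.
Proof.
have [_ cS _] := f_test; set S := closure _ in cS.
have cf : {within S, continuous f} by exact: continuous_subspaceT.
have /compact_bounded[r [_ rP]] := continuous_compact cf cS.
exists (`|r| + 1) => t x; rewrite /u.
have [->|fx] := eqVneq (f (t, X t x)) 0; first by rewrite normr0 addr_ge0.
apply: (rP (`|r| + 1)); first by rewrite (le_lt_trans (ler_norm _))// ltrDl.
by exists (t, X t x) => //; exact: subset_closure.
Qed.

Let bounded_continuous_integrable (h : V -> R) (B : R) :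
  continuous h -> (forall x, `|h x| <= B) -> mu0.-integrable setT (EFin \o h).
Proof.
move=> ch hB; apply: measurable_bounded_integrable => //.
- exact: (le_lt_trans (probability_le1 mu0 measurableT) (ltry _)).
- exact: continuous_measurable_mxr.
- exists B; split; first by rewrite num_real.
  by move=> r Br x _ /=; exact: le_trans (hB x) (ltW Br).
Qed.

(** Divided by h, the quadratic remainder of [X_vel] is O(|h|). Since h takes both signs and [X_vel]
    holds on [0, T] only, t is interior. *)
Let X_derive t x : 0 < t < T -> is_derive t 1 (X^~ x) (W t x).
Proof.
move=> /andP[t0 tT]; apply: cvg_is_derive; apply/cvgrPdist_le => e e0.
pose C := (K + L) * M.
have C0 : 0 < C by rewrite mulr_gt0// addr_gt0.
near=> h.
have h0 : h != 0 by near: h; exact: nbhs_dnbhs_neq.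
have he : `|h| <= e / C by near: h; apply: dnbhs0_le; rewrite divr_gt0.
have ht : `|h| <= t by near: h; exact: dnbhs0_le.
have hT : `|h| <= T - t by near: h; apply: dnbhs0_le; rewrite subr_gt0.
have htT : 0 <= h + t <= T.
  by move: ht hT; rewrite !ler_norml => /andP[h1 h2] /andP[h3 h4]; apply/andP; split; lra.
have tT' : 0 <= t <= T by rewrite !ltW.
have := X_vel x tT' htT; rewrite addrK -/(W t x) -/C => est.
apply: (le_trans (norm_le_enorm _)); rewrite edistC.
have -> : h^-1 *: (X (h + t) x - X t x) - W t x =
    h^-1 *: (X (h + t) x - X t x - h *: W t x).
  by rewrite [RHS]scalerBr scalerA mulVf// scale1r.
rewrite enormZ normfV ler_pdivrMl ?normr_gt0//; apply: (le_trans est).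
rewrite expr2 mulrCA ler_wpM2l//.
by rewrite mulrC -ler_pdivlMr.
Unshelve. all: by end_near. Qed.

Let u_derive t x : 0 < t < T -> is_derive t 1 (u^~ x) (g t x).
Proof.
move=> tT; have /is_derive_cvg dX := X_derive x tT.
pose c s : R * V := (s, X s x).
have dc : is_derive t 1 c (1, W t x).
  apply: cvg_is_derive.
  rewrite (_ : (fun h : R => _) = fun h => (h^-1 * h, h^-1 *: (X (h + t) x - X t x))); last first.
    by apply/funext => h; have -> : h^-1 * h = h^-1 *: (h + t - t) by rewrite addrK.
  have h1 : (fun h : R => h^-1 * h) @ 0^' --> (1 : R).
    by apply: cvg_near_cst; near=> h; rewrite mulVf//; near: h; exact: nbhs_dnbhs_neq.
  exact: (cvg_pair h1 dX).
have [dc1 dcE] := dc.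
have dfc := test_function_differentiable f_test (c t).
have dcd : differentiable c t by exact/derivable1_diffP.
rewrite /u -/(c _); have -> : (fun s => f (c s)) = f \o c by [].
apply: DeriveDef; first by apply/derivable1_diffP; exact: differentiable_comp.
rewrite deriveE; last exact: differentiable_comp.
by rewrite diff_comp//= -(deriveE _ dcd) dcE.
Unshelve. all: by end_near. Qed.

Let F t := (\int[mu0]_x u t x)%R.
Let G t := (\int[mu0]_x g t x)%R.

(** The open interval contains [0, T], so continuity up to the end points, which the fundamental
    theorem requires, follows from the two-sided one. *)
Let F_cont : {in `]-1, T + 1[%classic, continuous F}.
Proof.
have [B uB] := u_bound.
apply: (@continuity_under_integral _ _ _ _ u setT measurableT (-1) (T + 1) _ _ (cst B)).
- by move=> t _; exact: (bounded_continuous_integrable (@u_cont t) (uB t)).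
- by apply: aeW => x _ t _; exact: u_cont_time.
- apply: (@bounded_continuous_integrable _ `|B|) => //; exact: cst_continuous.
- by move=> t _; apply: aeW => x _; exact: uB.
Qed.

Let G_cont : {in `]-1, T + 1[%classic, continuous G}.
Proof.
have [B _ gB] := g_bound.
apply: (@continuity_under_integral _ _ _ _ g setT measurableT (-1) (T + 1) _ _ (cst B)).
- by move=> t _; exact: (bounded_continuous_integrable (@g_cont t) (gB t)).
- by apply: aeW => x _ t _; exact: g_cont_time.
- apply: (@bounded_continuous_integrable _ `|B|) => //; exact: cst_continuous.
- by move=> t _; apply: aeW => x _; exact: gB.
Qed.

Let F_derive t : 0 < t < T -> is_derive t 1 F (G t).
Proof.
move=> tT; have [[B B0 gB] [B' uB]] := (g_bound, u_bound).
have dE s x : 0 < s < T -> partial1of2 u s x = g s x.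
  by move=> sT; rewrite partial1of2E; have [_ ->] := u_derive x sT.
apply: cvg_is_derive.
have -> : G t = (\int[mu0]_x (partial1of2 u t x))%R.
  by apply: eq_Rintegral => x _; rewrite dE.
have It : `]0, T[%classic t by rewrite /= in_itv.
apply: (@cvg_differentiation_under_integral _ _ _ _ u setT measurableT t 0 T It _ _ (cst B)) => //.
- by move=> s _; exact: (bounded_continuous_integrable (@u_cont s) (uB s)).
- by move=> s x; rewrite /= in_itv /= => sT _; have [] := u_derive x sT.
- apply: (@bounded_continuous_integrable _ B) => //; first exact: cst_continuous.
  by move=> x; rewrite /= ger0_norm.
- by move=> s x; rewrite /= in_itv /= => sT _; rewrite dE.
Qed.

Let inner_integralE t :
  (\int[mub t]_x (dtime f t x + dotp (grad f t x) (v (mub t) x))%:E = (G t)%:E)%E.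
Proof.
have [B _ gB] := g_bound; have [mX mubE] := Xmub t.
pose h x := 'd f (t, x) (1, v (mub t) x).
have hE x : dtime f t x + dotp (grad f t x) (v (mub t) x) = h x.
  exact: (test_function_integrandE f_test).
under eq_integral do rewrite hE.
have ch : continuous h.
  rewrite (funext (fun x => test_function_diffE f (t, x) (v (mub t) x) : h x = _)).
  apply: (@g_comp_continuous _ (fun=> t) id (v (mub t))).
  - exact: cst_continuous.
  - by move=> x; exact: cvg_id.
  - exact: elipschitz_continuous (vL (mub t)).
have mh : measurable_fun setT (EFin \o h).
  by apply/measurable_EFinP; exact: continuous_measurable_mxr.
have ig := bounded_continuous_integrable (@g_cont t) (gB t).
rewrite (@eq_measure_integral _ _ _ _ (pushforward mu0 (X t))); last first.
  by move=> A mA _; exact: (congr1 (fun m => m A) mubE).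
rewrite (integral_pushforward mX mh)//.
rewrite /G /Rintegral fineK//; exact: integrable_fin_num.
Qed.

Lemma weak_solution :
  (\int[@lebesgue_measure R]_(t in [set` `[0, T]%R])
     \int[mub t]_x (dtime f t x + dotp (grad f t x) (v (mub t) x))%:E = 0)%E.
Proof.
under eq_integral do rewrite inner_integralE.
have in_big t : 0 <= t <= T -> t \in (`]-1, T + 1[%classic : set R).
  by move=> /andP[t0 tT]; rewrite inE /= in_itv /=; apply/andP; split; lra.
rewrite (@continuous_FTC2 _ G F).
- have u0 t x : ~~ (0 < t < T) -> u t x = 0 by exact: test_function_eq0.
  have F0 t : ~~ (0 < t < T) -> F t = 0.
    by move=> tT; rewrite /F /Rintegral integral0_eq// => x _; rewrite u0.
  by rewrite !F0 ?ltxx ?andbF// subee.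
- exact: T_gt0.
- apply: continuous_in_subspaceT => t; rewrite inE /= in_itv /= => tT.
  exact/G_cont/in_big.
- split.
  + by move=> t; rewrite in_itv /= => tT; have [] := F_derive tT.
  + by apply: cvg_at_right_filter; apply/F_cont/in_big; rewrite lexx ltW.
  + by apply: cvg_at_left_filter; apply/F_cont/in_big; rewrite lexx ltW.
- move=> t; rewrite in_itv /= => tT; rewrite derive1E.
  by have [_ ->] := F_derive tT.
Qed.

End weak_formulation.

Theorem theorem2 (R : realType) (n : nat) (p T : R)
    (v : Pp n p -> 'rV[R]_n -> 'rV[R]_n) (mu0 : Pp n p)
    (muk : nat -> R -> Pp n p) :
  1 <= p -> 0 < T ->
  hypH v -> Pcac mu0 ->
  (forall k, scheme1 T v mu0 (2 ^ k) (muk k)) ->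
  exists mubar : R -> Pp n p,
    cvg_curve T muk mubar /\ is_solution T v mu0 mubar.
Proof.
move=> p1 T0 /hypH_lipschitz[L [M [K [L0 M0 K0 vLMK]]]] [supp0 ac0] sch.
have p0 : 0 < p by exact: lt_le_trans p1.
have pow_gt0 k : (0 < 2 ^ k)%N by rewrite expn_gt0.
have /choice[Xk Xk_flow] k := scheme1_lagrangian_flow T0 vLMK (pow_gt0 k) (sch k).
have [X [mub [Xlim Xclamp Xmub]]] :=
  limit_flow_exists p0 T0 L0 M0 K0 vLMK Xk_flow.
have Xtime := limit_flow_time_lipschitz T0 M0 vLMK Xk_flow Xlim Xclamp.
have Xbilip := limit_flow_bilipschitz T0 L0 vLMK Xk_flow Xlim Xclamp.
have Xtr := limit_flow_transports Xmub.
have Xktr k := lagrangian_flow_transports (Xk_flow k).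
have mub_cont : Ccurve T mub.
  apply: (@Ccurve_lipschitz _ _ _ _ M) => s t _ _.
  have [[ms mus] [mt mut]] := (Xtr s, Xtr t).
  by apply: (Wp_le_dist p0 ms mt mus mut) => //; rewrite mulr_ge0// ltW.
exists mub; split; split => //.
- move=> k; apply: (@Ccurve_lipschitz _ _ _ _ M) => s t sT tT.
  have [[ms mus] [mt mut]] := (Xktr k s sT, Xktr k t tT).
  apply: (Wp_le_dist p0 ms mt mus mut); first by rewrite mulr_ge0// ltW.
  move=> x; wlog st : s t sT tT {ms mus mt mut} / s <= t.
    by move=> wl; case: (leP s t) => [|/ltW] /wl; [|rewrite distrC edistC]; exact.
  rewrite edistC distrC ger0_norm ?subr_ge0//.
  have [/andP[s0 _] /andP[_ tT']] := (sT, tT).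
  exact: (lagrangian_flow_time_lipschitz T0 vLMK (pow_gt0 k) (Xk_flow k)).
- apply: (dcurve_geometric (ltW T0)) => k t tT.
  have [[ms mus] [mt mut]] := (Xktr k t tT, Xtr t).
  apply: (Wp_le_dist p0 ms mt mus mut); last by move=> x; exact: Xlim.
  by rewrite divr_ge0 ?exprn_ge0// !mulr_ge0 ?expR_ge0// ltW.
- move=> t _; have [mX mubE] := Xmub t; split.
    apply: (compact_support_pushforward mX _ mubE supp0) => x.
    (* The displacement is at most M |t|, because the limit flow starts at the identity. *)
    by have := Xtime 0 t x; rewrite (limit_flow0 T0 Xk_flow Xlim); exact.
  by apply: (pushforward_null_dominates (expR_gt0 (L * T)) (fun x y => (Xbilip t x y).2) mX mubE).
- move=> A mA; have [_ ->//] := Xtr 0; rewrite /pushforward; congr (mu0 _).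
  apply/funext => x /=; congr A.
  exact: (limit_flow0 T0 Xk_flow Xlim).
- move=> f f_test.
  apply: (weak_solution p0 T0 L0 M0 K0 vLMK Xmub Xtime (fun t x y => (Xbilip t x y).1) _ f_test).
  move=> s t x sT tT.
  exact: (limit_flow_velocity p0 T0 L0 M0 vLMK Xk_flow Xlim Xclamp Xmub x sT tT).
Qed.
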